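(* Let $k$ be the residue field of a perfectoid field $K$ of residue characteristic $p$, let $0\le r\le n$, and let $$R=k\big[X_1^{1/p^\infty},\dots,X_r^{1/p^\infty},X_{r+1}^{\pm1/p^\infty},\dots,X_n^{\pm1/p^\infty}\big].$$ Every finite projective $R$-module is free. In particular (letting $r=n$), every finite projective module over $\tilde T_n^{\mathrm{perf}}=k[X_1^{1/p^\infty},\dots,X_n^{1/p^\infty}]$ is free.
   Context: $R$ is the union over $m\ge0$ of the Laurent polynomial rings $k[X_1^{1/p^m},\dots,X_r^{1/p^m},X_{r+1}^{\pm1/p^m},\dots,X_n^{\pm1/p^m}]$. The ring $\tilde T_n^{\mathrm{perf}}$ is the quotient of the subring of power-bounded elements of the perfectoid Tate algebra $K\langle X_1^{1/p^\infty},\dots,X_n^{1/p^\infty}\rangle$ by its ideal of topologically nilpotent elements. *)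

(* Defs.v *)
From HB Require Import structures.
From mathcomp Require Import all_boot all_order all_algebra.
From mathcomp Require Import generic_quotient ring_quotient finmap.
From mathcomp Require Import boolp classical_sets functions reals.
From mathcomp Require Import topology normedtype sequences.
(* The notations of monalg clash with those of the topology files, so they are
   left out: [mcoeff e g] is the coefficient of [g] at [e], [msupp g] the
   support of [g], and [mkmalgU e c] the one-term element [c X^e]. *)
From mathcomp.multinomials Require Import -(notations) monalg.

Set Implicit Arguments.
Unset Strict Implicit.
Unset Printing Implicit Defensive.

Import Order.TTheory GRing.Theory Num.Theory.
Import numFieldNormedType.Exports.

Local Open Scope ring_scope.
Local Open Scope classical_set_scope.
Local Open Scope quotient_scope.

(* The norms of MathComp satisfy [`|x *+ n| = `|x| *+ n], which excludes
   nonarchimedean ones; hence these structures. *)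
HB.mixin Record ComNzRing_hasUltranorm (R : realType) A
    of GRing.ComNzRing A := {
  unorm : A -> R;
  unorm_ge0 : forall x, 0 <= unorm x;
  unorm_eq0 : forall x, unorm x = 0 <-> x = 0;
  unorm1 : unorm 1 = 1;
  unormB : forall x y, unorm (x - y) <= Num.max (unorm x) (unorm y);
  unormM_le : forall x y, unorm (x * y) <= unorm x * unorm y
}.

#[short(type="ultraRingType")]
HB.structure Definition UltraRing (R : realType) :=
  {A of GRing.ComNzRing A & ComNzRing_hasUltranorm R A}.

HB.mixin Record UltraRing_isValued (R : realType) A of UltraRing R A := {
  unormM : forall x y : A, unorm (x * y) = unorm x * unorm y
}.

#[short(type="valuedFieldType")]
HB.structure Definition ValuedField (R : realType) :=
  {K of GRing.Field K & UltraRing R K & UltraRing_isValued R K}.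

Section UltraTheory.
Variables (R : realType) (A : ultraRingType R).
Implicit Types x y : A.

Lemma unorm0 : unorm (0 : A) = 0. Proof. exact/unorm_eq0. Qed.

Lemma unormN_le x : unorm (- x) <= unorm x.
Proof.
by rewrite -sub0r; apply: (le_trans (unormB _ _)); rewrite unorm0 ge_max
  lexx unorm_ge0.
Qed.

Lemma unormN x : unorm (- x) = unorm x.
Proof. by apply/le_anti; rewrite unormN_le -{1}(opprK x) unormN_le. Qed.

Lemma unormBC x y : unorm (x - y) = unorm (y - x).
Proof. by rewrite -unormN opprB. Qed.

Lemma unormD x y : unorm (x + y) <= Num.max (unorm x) (unorm y).
Proof. by rewrite -{1}(opprK y) -(unormN y) unormB. Qed.

Lemma unormD_bound C x y : unorm x <= C -> unorm y <= C -> unorm (x + y) <= C.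
Proof. by move=> hx hy; apply: le_trans (unormD _ _) _; rewrite ge_max hx. Qed.

Lemma unormB_bound C x y : unorm x <= C -> unorm y <= C -> unorm (x - y) <= C.
Proof. by move=> hx hy; apply: unormD_bound; rewrite ?unormN. Qed.

Lemma unorm_sum C (I : Type) (r : seq I) (P : pred I) (F : I -> A) :
  0 <= C -> (forall i, P i -> unorm (F i) <= C) ->
  unorm (\sum_(i <- r | P i) F i) <= C.
Proof.
move=> C0 hF; elim/big_ind: _ => //; first by rewrite unorm0.
by move=> x y; apply: unormD_bound.
Qed.

Lemma unormMn x n : unorm (x *+ n) <= unorm x.
Proof.
elim: n => [|n IH]; first by rewrite mulr0n unorm0 unorm_ge0.
by rewrite mulrS unormD_bound.
Qed.

Lemma unormX_sign x n : unorm ((- x) ^+ n) = unorm (x ^+ n).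
Proof.
by rewrite exprNn -signr_odd; case: odd; rewrite /= ?expr1 ?expr0 ?mul1r //
  mulN1r unormN.
Qed.

Lemma unorm_dist x y : `|unorm x - unorm y| <= unorm (x - y).
Proof.
have h (a b : A) : unorm a <= unorm b + unorm (a - b).
  rewrite -{1}(subrK b a); apply: (le_trans (unormD _ _)).
  by rewrite ge_max lerDr lerDl !unorm_ge0.
by rewrite ler_distl lerBlDr h {1}unormBC h.
Qed.

End UltraTheory.

Section Reduction.
Variables (R : realType) (A : ultraRingType R).

Definition power_bounded : {pred A} :=
  [pred x | `[< exists C : R, forall n, unorm (x ^+ n) <= C >]].

Definition top_nilpotent : {pred A} :=
  [pred x | `[< unorm (x ^+ n) @[n --> \oo] --> (0 : R) >]].

Lemma power_boundedP x : reflect (exists C : R, forall n, unorm (x ^+ n) <= C)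
  (x \in power_bounded).
Proof. exact: asboolP. Qed.

Lemma top_nilpotentP x :
  reflect (forall e : R, 0 < e ->
             exists N, forall n, (N <= n)%N -> unorm (x ^+ n) < e)
          (x \in top_nilpotent).
Proof.
apply: (iffP (asboolP _)) => [/cvgr0Pnorm_lt h e e0|h].
  have [N _ hN] := h e e0; exists N => n /hN /=.
  by rewrite ger0_norm ?unorm_ge0.
apply/cvgr0Pnorm_lt => e /h[N hN]; exists N => // n /hN /=.
by rewrite ger0_norm ?unorm_ge0.
Qed.

Lemma power_bounded_subring : subring_closed power_bounded.
Proof.
split=> [|x y /power_boundedP[C hC] /power_boundedP[D hD]
         |x y /power_boundedP[C hC] /power_boundedP[D hD]]; apply/power_boundedP.
- by exists 1 => n; rewrite expr1n unorm1.
- exists (C * D) => n; rewrite exprDn.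
  have C0 : 0 <= C by apply: le_trans (hC 0%N); apply: unorm_ge0.
  have D0 : 0 <= D by apply: le_trans (hD 0%N); apply: unorm_ge0.
  apply: unorm_sum => [|i _]; first exact: mulr_ge0.
  apply: le_trans (unormMn _ _) _; apply: le_trans (unormM_le _ _) _.
  by rewrite unormX_sign ler_pM ?unorm_ge0.
- exists (C * D) => n; rewrite exprMn.
  by apply: le_trans (unormM_le _ _) _; rewrite ler_pM ?unorm_ge0.
Qed.

HB.instance Definition _ :=
  GRing.isSubringClosed.Build A power_bounded power_bounded_subring.

Record bounded_ring : predArgType :=
  BoundedRing { bval : A; bvalP : bval \in power_bounded }.

HB.instance Definition _ := [isSub for bval].
HB.instance Definition _ := [Choice of bounded_ring by <:].
HB.instance Definition _ :=
  [SubChoice_isSubComNzRing of bounded_ring by <:].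

Definition nilpotent_ideal : {pred bounded_ring} :=
  [pred x | bval x \in top_nilpotent].

Lemma nilpotent_idealP : idealr_closed nilpotent_ideal.
Proof.
have E z : (z \in nilpotent_ideal) = (bval z \in top_nilpotent) by [].
split=> [||[a ha] [u hu] [v hv]]; rewrite !E /=.
- apply/top_nilpotentP => e e0; exists 1%N => -[//|n] _.
  by rewrite exprS mul0r unorm0.
- apply/negP => /top_nilpotentP /(_ 1 ltr01) [N /(_ N (leqnn N))].
  by rewrite expr1n unorm1 ltxx.
move=> nu nv.
have hau : a * u \in power_bounded by rewrite rpredM.
have {}nu : a * u \in top_nilpotent.
  case/power_boundedP: ha => C hC; apply/top_nilpotentP => e e0.
  have C1 : 0 < C by apply: lt_le_trans (hC 0%N); rewrite expr0 unorm1.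
  have [|N hN] := top_nilpotentP _ nu (e / C); first exact: divr_gt0.
  exists N => n /hN h; rewrite exprMn; apply: le_lt_trans (unormM_le _ _) _.
  apply: (@le_lt_trans _ _ (C * unorm (u ^+ n))).
    by rewrite ler_wpM2r ?unorm_ge0.
  by rewrite mulrC -ltr_pdivlMr.
move: (a * u) hau nu => {ha hu}w hw nw.
case/power_boundedP: hw => C hC; case/power_boundedP: hv => D hD.
have C0 : 0 < C by apply: lt_le_trans (hC 0%N); rewrite expr0 unorm1.
have D0 : 0 < D by apply: lt_le_trans (hD 0%N); rewrite expr0 unorm1.
apply/top_nilpotentP => e e0.
have e20 : 0 < e / 2 by rewrite divr_gt0.
have [|N hN] := top_nilpotentP _ nw (e / 2 / D); first exact: divr_gt0.
have [|M hM] := top_nilpotentP _ nv (e / 2 / C); first exact: divr_gt0.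
exists (N + M)%N => n hn; apply: (@le_lt_trans _ _ (e / 2)); last first.
  by rewrite ltr_pdivrMr // ltr_pMr // ltr1n.
rewrite exprDn; apply: unorm_sum => [|i _]; first exact: ltW.
apply: le_trans (unormMn _ _) _; apply: le_trans (unormM_le _ _) _.
have [hi|hi] := leqP M i.
  apply: (@le_trans _ _ (C * unorm (v ^+ i))).
    by rewrite ler_wpM2r ?unorm_ge0.
  by rewrite mulrC -ler_pdivlMr // ltW // hM.
have {}hi : (N <= n - i)%N.
  have him : (i + N <= n)%N.
    by apply: leq_trans hn; rewrite addnC leq_add2l ltnW.
  by rewrite leq_subRL // (leq_trans _ him) // leq_addr.
apply: (@le_trans _ _ (unorm (w ^+ (n - i)) * D)).
  by rewrite ler_wpM2l ?unorm_ge0.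
by rewrite -ler_pdivlMr // ltW // hN.
Qed.

HB.instance Definition _ :=
  isIdealr.Build bounded_ring nilpotent_ideal nilpotent_idealP.

(* The ring of power-bounded elements modulo the topologically nilpotent ones.
   For a valued field these are the valuation ring and its maximal ideal, so
   [reduction] is the residue field. *)
Definition reduction := {ideal_quot nilpotent_ideal}.

HB.instance Definition _ := GRing.ComNzRing.on reduction.

Definition red (x : bounded_ring) : reduction := \pi_({ideal_quot nilpotent_ideal}) x.

End Reduction.

Arguments reduction {R} A.
Arguments bounded_ring {R} A.

Section Completion.
Variables (R : realType) (A : ultraRingType R).

Definition is_cauchy (u : nat -> A) : Prop := forall e : R, 0 < e ->
  exists N, forall m n, (N <= m)%N -> (N <= n)%N -> unorm (u m - u n) < e.

Definition is_limit (u : nat -> A) (l : A) : Prop :=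
  unorm (u n - l) @[n --> \oo] --> (0 : R).

Definition cauchy_pred : {pred (nat -> A)} := [pred u | `[< is_cauchy u >]].

Lemma is_cauchy_bounded u : is_cauchy u ->
  exists2 C : R, 0 < C & forall n, unorm (u n) <= C.
Proof.
move=> /(_ 1 ltr01)[N hN].
have [C hC] : exists C : R, forall n, (n < N)%N -> unorm (u n) <= C.
  elim: N {hN} => [|N [C hC]]; first by exists 0.
  exists (Num.max C (unorm (u N))) => n; rewrite ltnS leq_eqVlt.
  by case/predU1P => [->|/hC h]; rewrite le_max ?lexx ?orbT ?h.
exists (Num.max (Num.max C 1) (unorm (u N))); first by rewrite !lt_max ltr01 orbT.
move=> n; have [/hC h|h] := ltnP n N; first by rewrite !le_max h.
rewrite -(subrK (u N) (u n)); apply: le_trans (unormD _ _) _.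
rewrite ge_max !le_max lexx !orbT andbT.
by rewrite (ltW (hN _ _ h (leqnn N))) !orbT.
Qed.

Lemma cauchy_subring : subring_closed cauchy_pred.
Proof.
split=> [|u v /asboolP hu /asboolP hv|u v /asboolP hu /asboolP hv];
  apply/asboolP => e e0.
- by exists 0%N => m n _ _; rewrite subrr unorm0.
- have [N hN] := hu _ e0; have [M hM] := hv _ e0.
  exists (maxn N M) => m n; rewrite !geq_max => /andP[m1 m2] /andP[n1 n2].
  have -> : (u - v) m - (u - v) n = (u m - u n) - (v m - v n).
    by rewrite !fctE opprD addrACA -opprD.
  by apply: le_lt_trans (unormB _ _) _; rewrite gt_max hN ?hM.
- have [C C0 hC] := is_cauchy_bounded hu; have [D D0 hD] := is_cauchy_bounded hv.
  have [|N hN] := hu (e / D); first exact: divr_gt0.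
  have [|M hM] := hv (e / C); first exact: divr_gt0.
  exists (maxn N M) => m n; rewrite !geq_max => /andP[m1 m2] /andP[n1 n2].
  have -> : (u * v) m - (u * v) n = u m * (v m - v n) + (u m - u n) * v n.
    by rewrite !fctE mulrBr mulrBl addrA subrK.
  apply: le_lt_trans (unormD _ _) _; rewrite gt_max; apply/andP; split.
    apply: le_lt_trans (unormM_le _ _) _.
    apply: (@le_lt_trans _ _ (C * unorm (v m - v n))).
      by rewrite ler_wpM2r ?unorm_ge0.
    by rewrite mulrC -ltr_pdivlMr // hM.
  apply: le_lt_trans (unormM_le _ _) _.
  apply: (@le_lt_trans _ _ (unorm (u m - u n) * D)).
    by rewrite ler_wpM2l ?unorm_ge0.
  by rewrite -ltr_pdivlMr // hN.
Qed.

HB.instance Definition _ :=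
  GRing.isSubringClosed.Build (nat -> A) cauchy_pred cauchy_subring.

Record cauchy_ring : predArgType :=
  CauchyRing { cval : nat -> A; cvalP : cval \in cauchy_pred }.

HB.instance Definition _ := [isSub for cval].
HB.instance Definition _ := [Choice of cauchy_ring by <:].
HB.instance Definition _ := [SubChoice_isSubComNzRing of cauchy_ring by <:].

Definition null_ideal : {pred cauchy_ring} :=
  [pred u | `[< is_limit (cval u) 0 >]].

Lemma null_idealE u : u \in null_ideal <->
  unorm (cval u n) @[n --> \oo] --> (0 : R).
Proof.
have E : (fun n => unorm (cval u n - 0)) = (fun n => unorm (cval u n)).
  by apply/funext => n; rewrite subr0.
by split=> [/asboolP|h]; [|apply/asboolP]; rewrite /is_limit E.
Qed.

Lemma null_idealP : idealr_closed null_ideal.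
Proof.
split.
- by apply/null_idealE; under eq_fun do rewrite unorm0; exact: cvg_cst.
- apply/negP => /null_idealE /cvgr0Pnorm_lt /(_ 1 ltr01)[N _ /(_ N (leqnn N))].
  by rewrite /= unorm1 normr1 ltxx.
move=> a u v /null_idealE hu /null_idealE hv; apply/null_idealE.
have [C C0 hC] := is_cauchy_bounded (asboolW (cvalP a)).
have h : C * unorm (cval u n) + unorm (cval v n) @[n --> \oo] --> (0 : R).
  by rewrite -[0](addr0 (0 : R)) -{1}(mulr0 C); apply: cvgD => //; apply: cvgMr.
apply: (squeeze_cvgr _ (@cvg_cst _ (0 : R) _ _ _) h).
apply: nearW => n; rewrite unorm_ge0 /=; apply: le_trans (unormD _ _) _.
have h1 : unorm (cval a n * cval u n) <= C * unorm (cval u n).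
  by apply: le_trans (unormM_le _ _) _; rewrite ler_wpM2r ?unorm_ge0.
rewrite ge_max lerDr (le_trans (unorm_ge0 _) h1) andbT.
by apply: le_trans h1 _; rewrite lerDl unorm_ge0.
Qed.

HB.instance Definition _ := isIdealr.Build cauchy_ring null_ideal null_idealP.

Definition completion := {ideal_quot null_ideal}.

HB.instance Definition _ := GRing.ComNzRing.on completion.

Definition cauchy_norm (u : cauchy_ring) : R :=
  lim (unorm (cval u n) @[n --> \oo]).

Definition completion_norm (x : completion) : R := cauchy_norm (repr x).

Lemma cauchy_norm_cvg u : unorm (cval u n) @[n --> \oo] --> cauchy_norm u.
Proof.
suff : cvg (unorm (cval u n) @[n --> \oo]) by [].
apply: cauchy_cvg; apply: cauchy_exP => e e0.
have [N hN] := asboolW (cvalP u) e e0.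
exists (unorm (cval u N)); exists N => // n /= hn.
by rewrite /ball /=; apply: le_lt_trans (unorm_dist _ _) _; apply: hN.
Qed.

Lemma cauchy_norm_mod u v : u = v %[mod completion] ->
  cauchy_norm u = cauchy_norm v.
Proof.
move/eqP; rewrite -Quotient.idealrBE => /null_idealE h.
apply/eqP; rewrite -subr_eq0 -normr_eq0; apply/eqP.
have h1 : `|unorm (cval u n) - unorm (cval v n)| @[n --> \oo]
            --> `|cauchy_norm u - cauchy_norm v|.
  by apply: cvg_norm; apply: cvgB; apply: cauchy_norm_cvg.
apply: (cvg_unique _ h1) => //.
apply: (squeeze_cvgr _ (@cvg_cst _ (0 : R) _ _ _) h).
by apply: nearW => n; rewrite normr_ge0 unorm_dist.
Qed.

Lemma completion_norm_pi u :
  completion_norm (\pi_completion u) = cauchy_norm u.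
Proof. by apply: cauchy_norm_mod; rewrite reprK. Qed.

Lemma completion_norm_ge0 x : 0 <= completion_norm x.
Proof.
apply: limr_ge; last by apply: nearW => n; apply: unorm_ge0.
exact: cauchy_norm_cvg.
Qed.

Lemma completion_norm_eq0 x : completion_norm x = 0 <-> x = 0.
Proof.
elim/quotW: x => u; rewrite completion_norm_pi.
have -> : (\pi_completion u = 0) <-> u \in null_ideal.
  rewrite -(rmorph0 \pi_completion) -{2}(subr0 u).
  have -> : (u - 0 \in null_ideal) = (u == 0 %[mod completion]).
    exact: Quotient.idealrBE.
  by split=> /eqP.
split=> [h|/null_idealE h]; first by apply/null_idealE; rewrite -h; exact: cauchy_norm_cvg.
by apply: (cvg_lim _ h).
Qed.

Lemma completion_norm1 : completion_norm 1 = 1.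
Proof.
rewrite -(rmorph1 \pi_completion) completion_norm_pi.
apply: (@cvg_lim) => //.
by under eq_fun do rewrite unorm1; exact: cvg_cst.
Qed.

Lemma completion_normB x y :
  completion_norm (x - y) <= Num.max (completion_norm x) (completion_norm y).
Proof.
elim/quotW: x => u; elim/quotW: y => v.
rewrite -rmorphB !completion_norm_pi.
apply/ler_addgt0Pr => e e0.
apply: limr_le; first by apply/cvg_ex; eexists; exact: cauchy_norm_cvg.
have ev w M : cauchy_norm w <= M -> \forall n \near \oo, unorm (cval w n) <= M + e.
  move=> hM; have /cvgrPdist_le/(_ _ e0) := @cauchy_norm_cvg w.
  apply: filterS => n; rewrite ler_distlC => /andP[_ hn].
  by apply: le_trans hn _; rewrite lerD2r.
set M := Num.max _ _.
have := ev u M; rewrite le_max lexx => /(_ isT) eu.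
have := ev v M; rewrite le_max lexx orbT => /(_ isT) ev'.
by apply: filterS2 eu ev' => n; apply: unormB_bound.
Qed.

Lemma completion_normM x y :
  completion_norm (x * y) <= completion_norm x * completion_norm y.
Proof.
elim/quotW: x => u; elim/quotW: y => v.
rewrite -rmorphM !completion_norm_pi.
have h : unorm (cval u n) * unorm (cval v n) @[n --> \oo]
   --> cauchy_norm u * cauchy_norm v.
  by apply: cvgM; apply: cauchy_norm_cvg.
rewrite -(cvg_lim _ h) //; apply: ler_lim.
- exact: cauchy_norm_cvg.
- by apply/cvg_ex; eexists; exact: h.
- by apply: nearW => n; apply: unormM_le.
Qed.

HB.instance Definition _ := ComNzRing_hasUltranorm.Build R completion
  completion_norm_ge0 completion_norm_eq0 completion_norm1
  completion_normB completion_normM.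

Lemma cst_cauchy (a : A) : (fun=> a) \in cauchy_pred.
Proof. by apply/asboolP => e e0; exists 0%N => m n _ _; rewrite subrr unorm0. Qed.

Definition to_completion (a : A) : completion :=
  \pi_completion (CauchyRing (cst_cauchy a)).

End Completion.

Arguments completion {R} A.

(* The product of monalg requires that [x * y = 1] force [x = y = 1], which
   excludes Laurent exponents; so we define the algebra [A[M]] of any
   commutative monoid [M], written additively, on the module [malg M A]. *)
Definition monoid_algebra (A : comNzRingType) (M : nmodType) := malg M A.

Section MonoidAlgebra.
Variables (A : comNzRingType) (M : nmodType).
Local Notation AM := (monoid_algebra A M).

HB.instance Definition _ := GRing.Zmodule.on AM.

Implicit Types g : AM.

Definition mterm (c : A) (e : M) : AM := mkmalgU e c.

Definition mone : AM := mterm 1 0.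

Definition mmul g1 g2 : AM :=
  \sum_(e1 <- msupp g1) \sum_(e2 <- msupp g2)
     mterm (mcoeff e1 g1 * mcoeff e2 g2) (e1 + e2).

Lemma mterm0 e : mterm 0 e = 0. Proof. exact: monalgU0. Qed.

Lemma mtermD e : {morph mterm^~ e : c d / c + d}.
Proof. by move=> c d; apply: (monalgUD e). Qed.

Lemma mcoeff_term c e e' : mcoeff e' (mterm c e) = c *+ (e == e').
Proof. exact: mcoeffU. Qed.

Lemma mtermE g : g = \sum_(e <- msupp g) mterm (mcoeff e g) e.
Proof. exact: monalgE. Qed.

Lemma mmulw (d1 d2 : {fset M}) g1 g2 :
  (msupp g1 `<=` d1)%fset -> (msupp g2 `<=` d2)%fset ->
  mmul g1 g2 = \sum_(e1 <- d1) \sum_(e2 <- d2)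
     mterm (mcoeff e1 g1 * mcoeff e2 g2) (e1 + e2).
Proof.
move=> le1 le2; rewrite /mmul (big_fset_incl _ le1) /=.
  apply: eq_bigr => e1 _; apply: big_fset_incl => // e _ /mcoeff_outdom ->.
  by rewrite mulr0 mterm0.
move=> e _ /mcoeff_outdom h.
by rewrite big1 // => e' _; rewrite h mul0r mterm0.
Qed.

Lemma mmulC : commutative mmul.
Proof.
move=> g1 g2; rewrite /mmul exchange_big; apply: eq_bigr => e2 _.
by apply: eq_bigr => e1 _; rewrite mulrC addrC.
Qed.

Lemma mmul_term c1 c2 e1 e2 :
  mmul (mterm c1 e1) (mterm c2 e2) = mterm (c1 * c2) (e1 + e2).
Proof.
rewrite (mmulw msuppU_le msuppU_le) !big_seq_fset1.
by rewrite !mcoeff_term !eqxx !mulr1n.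
Qed.

Lemma mmulDl : left_distributive mmul +%R.
Proof.
move=> g1 g2 g.
have le1 := fsubsetUl (msupp g1) (msupp g2).
have le2 := fsubsetUr (msupp g1) (msupp g2).
have le0 := fsubset_refl (msupp g).
rewrite (mmulw le1 le0) (mmulw le2 le0) (mmulw (msuppD_le _ _) le0).
rewrite -big_split /=; apply: eq_bigr => e1 _.
rewrite -big_split /=; apply: eq_bigr => e2 _.
by rewrite (mcoeffD e1) mulrDl mtermD.
Qed.

Lemma mmulDr : right_distributive mmul +%R.
Proof. by move=> g g1 g2; rewrite !(mmulC g) mmulDl. Qed.

Lemma mmul0 : left_zero 0 mmul.
Proof. by move=> g; rewrite /mmul msupp0 big_seq_fset0. Qed.

Lemma mmul_suml (I : Type) (r : seq I) (F : I -> AM) g :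
  mmul (\sum_(i <- r) F i) g = \sum_(i <- r) mmul (F i) g.
Proof.
exact: (big_morph (mmul^~ g) (fun x y => mmulDl x y g) (mmul0 g)).
Qed.

Lemma mmul_sumr (I : Type) (r : seq I) (F : I -> AM) g :
  mmul g (\sum_(i <- r) F i) = \sum_(i <- r) mmul g (F i).
Proof. by rewrite mmulC mmul_suml; apply: eq_bigr => i _; rewrite mmulC. Qed.

Lemma mmul1 : left_id mone mmul.
Proof.
move=> g; rewrite [in LHS](mtermE g) mmul_sumr [RHS]mtermE.
by apply: eq_bigr => e _; rewrite mmul_term mul1r add0r.
Qed.

Lemma mmulA : associative mmul.
Proof.
move=> g1 g2 g3; rewrite (mtermE g1) (mtermE g2) (mtermE g3).
rewrite !mmul_suml; apply: eq_bigr => e1 _.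
rewrite [LHS]mmul_sumr [X in _ = mmul X _]mmul_sumr mmul_suml.
apply: eq_bigr => e2 _.
rewrite !mmul_sumr; apply: eq_bigr => e3 _.
by rewrite !mmul_term mulrA addrA.
Qed.

Lemma mone_neq0 : mone != 0.
Proof.
apply/eqP => /(congr1 (mcoeff 0)) /eqP.
by rewrite mcoeff_term eqxx mulr1n (mcoeff0 (0 : M)) oner_eq0.
Qed.

HB.instance Definition _ := GRing.Zmodule_isComNzRing.Build AM
  mmulA mmulC mmul1 mmulDl mone_neq0.

End MonoidAlgebra.

Section GaussNorm.
Variables (R : realType) (A : ultraRingType R) (M : nmodType).
Local Notation AM := (monoid_algebra A M).
Implicit Types g : AM.

Definition gauss_norm g : R :=
  \big[Num.max/0]_(e <- msupp g) unorm (mcoeff e g).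

Lemma gauss_norm_ge0 g : 0 <= gauss_norm g.
Proof. exact: bigmax_ge_id. Qed.

Lemma unorm_coeff_le g e : unorm (mcoeff e g) <= gauss_norm g.
Proof.
have [h|h] := boolP (e \in msupp g); first exact: (@le_bigmax_seq _ _ _ _ 0 e xpredT
    (fun e => unorm (mcoeff e g))).
by rewrite (mcoeff_outdom h) unorm0 gauss_norm_ge0.
Qed.

Lemma gauss_norm_le g C : 0 <= C -> (forall e, unorm (mcoeff e g) <= C) ->
  gauss_norm g <= C.
Proof.
move=> C0 hC; rewrite /gauss_norm; apply: (big_ind (fun x => x <= C)) => //.
by move=> x y hx hy; rewrite ge_max hx.
Qed.

Lemma gauss_norm_eq0 g : gauss_norm g = 0 <-> g = 0.
Proof.
split=> [h|->]; last first.
  apply/le_anti; rewrite gauss_norm_ge0 andbT gauss_norm_le // => e.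
  by rewrite mcoeff0 unorm0.
apply/malgP => e; rewrite mcoeff0; apply/(@unorm_eq0 R).
by apply/le_anti; rewrite unorm_ge0 -h unorm_coeff_le.
Qed.

Lemma gauss_norm1 : gauss_norm 1 = 1.
Proof.
have E e : mcoeff e (1 : AM) = (0 == e)%:R by exact: mcoeff_term.
apply/le_anti/andP; split.
  apply: gauss_norm_le => // e; rewrite E.
  by case: eqP; rewrite ?unorm1 ?unorm0.
by apply: le_trans (unorm_coeff_le 1 0); rewrite E eqxx unorm1.
Qed.

Lemma gauss_normB g1 g2 :
  gauss_norm (g1 - g2) <= Num.max (gauss_norm g1) (gauss_norm g2).
Proof.
apply: gauss_norm_le => [|e]; first by rewrite le_max gauss_norm_ge0.
rewrite (mcoeffB e); apply: unormB_bound; rewrite le_max unorm_coeff_le ?orbT //.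
Qed.

Lemma gauss_normM g1 g2 : gauss_norm (g1 * g2) <= gauss_norm g1 * gauss_norm g2.
Proof.
have h0 : 0 <= gauss_norm g1 * gauss_norm g2 by rewrite mulr_ge0 ?gauss_norm_ge0.
apply: gauss_norm_le => // e; rewrite (raddf_sum (mcoeff e)).
apply: unorm_sum => // e1 _; rewrite (raddf_sum (mcoeff e)).
apply: unorm_sum => // e2 _; rewrite /= mcoeff_term.
apply: le_trans (unormMn _ _) _; apply: le_trans (unormM_le _ _) _.
by rewrite ler_pM ?unorm_ge0 ?unorm_coeff_le.
Qed.

HB.instance Definition _ := ComNzRing_hasUltranorm.Build R AM
  gauss_norm_ge0 gauss_norm_eq0 gauss_norm1 gauss_normB gauss_normM.

End GaussNorm.

Section Exponents.
Variables p r n : nat.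

Definition perf_exponent : {pred {ffun 'I_n -> rat}} :=
  [pred e : {ffun 'I_n -> rat} | [forall i : 'I_n,
     p.-nat `|denq (e i)|%N && ((i < r)%N ==> (0 <= e i))]].

Lemma pnat_denqD (x y : rat) :
  p.-nat `|denq x|%N -> p.-nat `|denq y|%N -> p.-nat `|denq (x + y)|%N.
Proof.
move=> hx hy.
have -> : x + y =
    (numq x * denq y + numq y * denq x)%:~R / (denq x * denq y)%:~R.
  rewrite -{1}(divq_num_den x) -{1}(divq_num_den y).
  by rewrite addf_div ?intr_eq0 ?denq_neq0 // !rmorphM -!rmorphM -rmorphD rmorphM.
have : p.-nat (absz (denq x * denq y)%R) by rewrite abszM pnatM hx.
case: divqP => [/eqP|k z k0]; first by rewrite mulf_eq0 !denq_eq0.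
by rewrite abszM pnatM => /andP[].
Qed.

Lemma perf_exponent_closed : Algebra.nmod_closed perf_exponent.
Proof.
split=> [|e f /forallP he /forallP hf]; apply/forallP => i; rewrite ffunE.
  by rewrite lexx implybT.
have /andP[h1 h2] := he i; have /andP[h3 h4] := hf i.
rewrite pnat_denqD //=; apply/implyP => hi.
by rewrite addr_ge0 ?(implyP h2) ?(implyP h4).
Qed.

(* The exponents of the monomials X^e of the [p]-power-root Laurent polynomial
   rings: [e_0, ..., e_(n-1)] in Z[1/p], with [e_i >= 0] for [i < r]. *)
Record exponent : predArgType :=
  Exponent { expval : {ffun 'I_n -> rat}; expvalP : expval \in perf_exponent }.

HB.instance Definition _ := [isSub for expval].
HB.instance Definition _ := [Choice of exponent by <:].
HB.instance Definition _ :=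
  GRing.SubChoice_isSubNmodule.Build _ _ exponent perf_exponent_closed.

End Exponents.

(* The union over m of
   k[X_1^(1/p^m), ..., X_r^(1/p^m), X_(r+1)^(+-1/p^m), ..., X_n^(+-1/p^m)]. *)
Definition perf_laurent (k : comNzRingType) (p r n : nat) :=
  monoid_algebra k (exponent p r n).

HB.instance Definition _ (k : comNzRingType) p r n :=
  GRing.ComNzRing.on (perf_laurent k p r n).

HB.instance Definition _ (R : realType) (A : ultraRingType R) p r n :=
  UltraRing.on (perf_laurent A p r n).

Section Perfectoid.
Variables (R : realType) (p : nat) (K : valuedFieldType R).

Definition is_complete (A : ultraRingType R) : Prop :=
  forall u : nat -> A, is_cauchy u -> exists l, is_limit u l.

Definition nondiscrete : Prop :=
  forall e : R, 1 < e -> exists x : K, 1 < unorm x < e.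

Definition frobenius_surjective_mod_p : Prop :=
  forall x : bounded_ring K,
    exists y z : bounded_ring K, x = y ^+ p + p%:R * z.

Definition is_perfectoid : Prop :=
  [/\ is_complete K, nondiscrete, p \in [pchar (reduction K)]
    & frobenius_surjective_mod_p].

(* K<X_1^(1/p^oo), ..., X_n^(1/p^oo)>: the completion of
   K[X_1^(1/p^oo), ..., X_n^(1/p^oo)] for the Gauss norm. *)
Definition perfectoid_tate (n : nat) := completion (perf_laurent K p n n).

HB.instance Definition _ n := UltraRing.on (perfectoid_tate n).

End Perfectoid.

Section Modules.
Variables (S : comNzRingType) (M : lmodType S).

Definition finitely_generated : Prop :=
  exists (d : nat) (s : 'I_d -> M),
    forall x, exists c : 'I_d -> S, x = \sum_i c i *: s i.

Definition projective : Prop :=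
  forall (N P : lmodType S) (g : {linear N -> P}) (f : {linear M -> P}),
    (forall y, exists x, g x = y) ->
    exists h : {linear M -> N}, forall x, g (h x) = f x.

Definition free_module : Prop :=
  exists (I : choiceType) (b : I -> M), forall x,
    exists! c : {fsfun I -> S with 0}, x = \sum_(i <- finsupp c) c i *: b i.

End Modules.

(* Main.v *)
Require Import Defs.
From HB Require Import structures.
From mathcomp Require Import all_boot all_order all_algebra.
From mathcomp Require Import reals.
From mathcomp Require Import perm generic_quotient ring_quotient finmap.
From mathcomp Require Import boolp classical_sets functions topology normedtype.
From mathcomp Require Import sequences zify ring lra.
From mathcomp.multinomials Require Import -(notations) monalg.

Set Implicit Arguments.
Unset Strict Implicit.
Unset Printing Implicit Defensive.

Import Order.TTheory GRing.Theory Num.Theory.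
Import numFieldNormedType.Exports.

Local Open Scope ring_scope.

(** A finite projective module is the image of an idempotent matrix E, and it is
    free when E = U V with V U = 1 ([projective_free]).  The finitely many
    exponents in E have a common denominator p^m, so E lives in the ordinary
    ring k[X_i^(1/p^m), X_j^(+-1/p^m)], and the theorem reduces to the theorem
    of Quillen and Suslin, with Swan's extension to Laurent polynomials
    ([laurent_ring_free], [perf_laurent_free]).  All rings concerned are viewed
    as subrings of one field L, so that a localization is just a larger subring.

    The proof is by induction on the number of variables.  Let A be B[x] or
    B[x, 1/x].  Replacing the coefficient field k by k(x) leaves one variable
    less, so E splits over the ring with coefficients k(x); clearing denominators, E splits over A[1/f] for
    a monic f in k[x], which may be taken with f(0) <> 0 in the Laurent case.
    Hence the module is isomorphic to a lattice W A^n in A^r that contains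
    f^2 A^r.  The quotient of A^r by the lattice is a B-direct summand of
    (A / f^2 A)^r, and the latter is B-free, with basis the x^j e_i.  By induction
    the quotient is B-free, say equal to B^m ([lattice_quotient_free]); let T be
    the matrix of x on it and let G be the matrix of the projection restricted to
    constant vectors.  The polynomial vectors of the lattice are then, up to the
    first m coordinates, the kernel of the pencil [x - T | G], and (T, G) is
    reachable: only B^m itself is a T-stable submodule containing the image of G.

    A reachable pencil over a domain is right equivalent over B[X] to a constant
    matrix ([reachable_trivial_pencil]).  Indeed the entries of G generate the
    unit ideal, by Quillen's patching it suffices to invert one entry g of G, and
    over B[1/g] this pivot splits off and leaves a smaller reachable pencil.  So
    the kernel of [x - T | G] is extended from the kernel of a surjective matrix
    over B, which is free by induction, and the lattice is free
    ([split_idempotent_adjoin]).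

    For the Tate algebra, the main point is that the Gauss norm over a valued field
    is multiplicative ([unorm_perf_laurentM]): two finite sets of exponents have a
    sum that is attained only once ([unique_sum]), which yields a coefficient of
    maximal norm in a product.  So is the norm of the completion; hence
    power-bounded means of norm at most 1, topologically nilpotent means of norm
    less than 1, and approximating by polynomials identifies the reduction with
    the perfected polynomial ring over the residue field
    ([tate_residue_map_bij]).  Freeness is transported along this isomorphism. *)

(** * Matrices with entries in a subring *)

Section OverBlocks.
Variables (R : Type) (S : {pred R}).

Lemma over_row_mx m p q (A : 'M[R]_(m, p)) (A' : 'M[R]_(m, q)) :
  (row_mx A A' \is a mxOver S) = (A \is a mxOver S) && (A' \is a mxOver S).
Proof.
apply/mxOverP/andP => [h|[/mxOverP h /mxOverP h'] i j].
  split; apply/mxOverP => i j; first by have := h i (lshift q j); rewrite row_mxEl.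
  by have := h i (rshift p j); rewrite row_mxEr.
by rewrite mxE; case: splitP.
Qed.

Lemma over_col_mx m p q (A : 'M[R]_(p, m)) (A' : 'M[R]_(q, m)) :
  (col_mx A A' \is a mxOver S) = (A \is a mxOver S) && (A' \is a mxOver S).
Proof.
apply/mxOverP/andP => [h|[/mxOverP h /mxOverP h'] i j].
  split; apply/mxOverP => i j; first by have := h (lshift q i) j; rewrite col_mxEu.
  by have := h (rshift p i) j; rewrite col_mxEd.
by rewrite mxE; case: splitP.
Qed.

Definition over_block_mx := (over_col_mx, over_row_mx).

End OverBlocks.

Section RightEquiv.
Variables (R : comNzRingType) (S : subringClosed R).

(** Equality up to the right action of GL_q(S).  The inverse is part of the data
    because its entries are required to lie in S as well. *)
Definition right_equiv m q (M N : 'M[R]_(m, q)) : Prop :=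
  exists U V : 'M[R]_q,
    [/\ U \is a mxOver S, V \is a mxOver S, U *m V = 1%:M & M *m U = N].

Lemma mxOver1 q : (1%:M : 'M[R]_q) \is a mxOver S.
Proof. by apply: mxOver_scalar; rewrite ?rpred0 ?rpred1. Qed.

Lemma right_equiv_refl m q (M : 'M[R]_(m, q)) : right_equiv M M.
Proof. by exists 1%:M, 1%:M; rewrite !mxOver1 !mulmx1. Qed.

Lemma right_equiv_trans m q (M N P : 'M[R]_(m, q)) :
  right_equiv M N -> right_equiv N P -> right_equiv M P.
Proof.
case=> U [V [hU hV UV <-]] [U' [V' [hU' hV' UV' <-]]].
exists (U *m U'), (V' *m V); split; rewrite ?mxOverM ?mulmxA //.
by rewrite -(mulmxA U) UV' mulmx1.
Qed.

End RightEquiv.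

(** * Reachable pencils *)

Section Pencil.
Variable L : fieldType.
Implicit Types (B : subringClosed L) (m r : nat).

(** The point s is a parameter because patching compares the values of the pencil at
    different points of B[X]. *)
Definition pencil (R : comNzRingType) m r (s : R) (T : 'M[R]_m)
  (G : 'M[R]_(m, r)) : 'M[R]_(m, m + r) := row_mx (s%:M - T) G.

Definition cst_mx m r (M : 'M[L]_(m, r)) : 'M[{poly L}]_(m, r) := map_mx polyC M.

(** B[X] under a name of its own, which can carry the subring structure. *)
Definition poly_ring B : {pred {poly L}} := polyOver_pred B.
HB.instance Definition _ B := GRing.SubringClosed.on (poly_ring B).

(** Then the kernel of the pencil over B[X] is extended from B. *)
Definition trivial_pencil B m r (T : 'M[L]_m) (G : 'M[L]_(m, r)) : Prop :=
  exists N, right_equiv (poly_ring B) (pencil 'X (cst_mx T) (cst_mx G)) (cst_mx N).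

(** Reachability of the linear system (T, G) over B, expressed by submodules instead
    of the surjectivity of [G, T G, T^2 G, ...]: in this form it passes to localizations
    and to quotients at once. *)
Definition reachable B m r (T : 'M[L]_m) (G : 'M[L]_(m, r)) : Prop :=
  forall S : 'cV[L]_m -> Prop,
    (forall v w, S v -> S w -> S (v + w)) ->
    (forall b v, b \in B -> S v -> S (b *: v)) ->
    (forall v, v \is a mxOver B -> S (G *m v)) ->
    (forall v, S v -> S (T *m v)) ->
  forall v, v \is a mxOver B -> S v.

Lemma mem_poly_ringC B b : (b%:P \in poly_ring B) = (b \in B).
Proof. exact: polyOverC. Qed.

Lemma cst_mx_over B m r (M : 'M[L]_(m, r)) :
  M \is a mxOver B -> cst_mx M \is a mxOver (poly_ring B).
Proof. by move/mxOverP=> h; apply/mxOverP=> i j; rewrite mxE mem_poly_ringC. Qed.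

(** The restriction to B^m of a submodule over B' is a submodule over B, so it
    contains the standard basis. *)
Lemma reachable_sub B B' m r (T : 'M[L]_m) (G : 'M[L]_(m, r)) :
  {subset B <= B'} -> reachable B T G -> reachable B' T G.
Proof.
move=> sBB' h S SD SZ SG ST v /mxOverP hv.
have S0 : S 0 by rewrite -(scale0r (G *m 0)); apply: SZ; rewrite ?rpred0 //;
  apply: SG; apply: mxOver0; rewrite rpred0.
have Se w : w \is a mxOver B -> S w.
  apply: h => // [b w' hb|w' hw']; first by apply: SZ; apply: sBB'.
  by apply: SG; apply: mxOverS hw'.
rewrite [v](matrix_sum_delta v); elim/big_ind: _ => // i _.
elim/big_ind: _ => // j _; apply: SZ; first exact: hv.
by apply: Se; apply/mxOverP => a b; rewrite mxE rpred_nat.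
Qed.

Lemma reachable_change B m r (T P P' : 'M[L]_m) (G : 'M[L]_(m, r))
    (Q Q' : 'M[L]_r) :
    P' \is a mxOver B -> Q' \is a mxOver B -> P *m P' = 1%:M -> Q *m Q' = 1%:M ->
  reachable B T G -> reachable B (P *m T *m P') (P *m G *m Q).
Proof.
move=> hP' hQ' PP' QQ' h S SD SZ SG ST v hv.
rewrite -(mul1mx v) -PP' -mulmxA; apply: (h (fun w => S (P *m w))).
- by move=> w w' Sw Sw'; rewrite mulmxDr; apply: SD.
- by move=> b w hb Sw; rewrite -scalemxAr; apply: SZ.
- move=> w hw; have := SG (Q' *m w) (mxOverM hQ' hw).
  by rewrite !mulmxA -(mulmxA _ Q) QQ' mulmx1.
- by move=> w /ST; rewrite !mulmxA -(mulmxA _ P' P) (mulmx1C PP') mulmx1.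
- exact: mxOverM.
Qed.

(** Because P [X - T | G] diag(P', Q) = [X - P T P' | P G Q]. *)
Lemma trivial_pencil_change B m r (T P P' : 'M[L]_m) (G : 'M[L]_(m, r))
    (Q Q' : 'M[L]_r) :
    P \is a mxOver B -> P' \is a mxOver B ->
    Q \is a mxOver B -> Q' \is a mxOver B -> P *m P' = 1%:M -> Q *m Q' = 1%:M ->
  trivial_pencil B (P *m T *m P') (P *m G *m Q) -> trivial_pencil B T G.
Proof.
move=> hP hP' hQ hQ' PP' QQ' [N hN]; have P'P := mulmx1C PP'.
have cM a b c (A : 'M[L]_(a, b)) (A' : 'M[L]_(b, c)) : cst_mx (A *m A') = cst_mx A *m cst_mx A'.
  exact: map_mxM.
have c1 q : cst_mx (1%:M : 'M[L]_q) = 1%:M by rewrite /cst_mx map_mx1.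
pose D (A : 'M[L]_m) (A' : 'M[L]_r) := block_mx (cst_mx A) 0 0 (cst_mx A').
have DM A A' C C' : D A A' *m D C C' = D (A *m C) (A' *m C').
  by rewrite /D mulmx_block !mulmx0 !mul0mx !addr0 add0r !cM.
have Dover A A' : A \is a mxOver B -> A' \is a mxOver B -> D A A' \is a mxOver (poly_ring B).
  by move=> hA hA'; rewrite /D !over_block_mx !cst_mx_over ?mxOver0 ?rpred0.
have E : cst_mx P *m pencil 'X (cst_mx T) (cst_mx G) *m D P' Q =
    pencil 'X (cst_mx (P *m T *m P')) (cst_mx (P *m G *m Q)).
  rewrite /pencil /D mul_mx_row mul_row_block !mulmx0 addr0 add0r -!cM.
  rewrite mulmxBr mulmxBl -!cM; congr (row_mx (_ - _) _).
  by rewrite -mulmxA mul_scalar_mx -scalemxAr -cM PP' c1 scalemx1.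
case: hN => U [V [hU hV UV hUV]].
exists (P' *m N), (D P' Q *m U), (V *m D P Q'); split; rewrite ?mxOverM ?Dover //.
- rewrite mulmxA -(mulmxA _ U) UV mulmx1 DM P'P QQ' /D !c1.
  by rewrite -scalar_mx_block.
- rewrite cM -hUV -E !mulmxA -cM P'P c1 mul1mx //.
Qed.

Lemma over_col p q s (w : 'M[L]_(p + q, s)) B :
  (w \is a mxOver B) = (usubmx w \is a mxOver B) && (dsubmx w \is a mxOver B).
Proof. by rewrite -{1}(vsubmxK w) over_col_mx. Qed.

(** This is the system induced on the quotient of B^(1 + m) by the first basis
    vector, which lies in the image of G.  The quotient is stable under T only up
    to multiples of the column c, so c becomes an input; its sign is the one
    it has in X - T. *)
Lemma reachable_block B m r (a : 'M[L]_1) b (c : 'M[L]_(m, 1)) (T : 'M[L]_m)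
    (G : 'M[L]_(m, r)) :
  block_mx a b c T \is a mxOver B -> G \is a mxOver B ->
  reachable B (block_mx a b c T) (block_mx (1%:M : 'M_1) 0 0 G) ->
  reachable B T (row_mx (- c) G).
Proof.
move=> hT hG h S SD SZ SG ST v hv.
have hTE (w : 'cV[L]_(1 + m)) : dsubmx (block_mx a b c T *m w) =
    c *m usubmx w + T *m dsubmx w.
  by rewrite -{1}(vsubmxK w) mul_block_col col_mxKd.
have hGE (w : 'cV[L]_(1 + r)) : block_mx (1%:M : 'M_1) 0 0 G *m w =
    col_mx (usubmx w) (G *m dsubmx w).
  by rewrite -{1}(vsubmxK w) mul_block_col !mul0mx mul1mx addr0 add0r.
have o0 p q : (0 : 'M[L]_(p, q)) \is a mxOver B by rewrite mxOver0 ?rpred0.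
have SG' (x : 'cV[L]_1) (w : 'cV[L]_r) : x \is a mxOver B -> w \is a mxOver B ->
    S (c *m x + G *m w).
  move=> hx hw; have := SG (col_mx (- x) w).
  by rewrite mul_row_col mulNmx mulmxN opprK over_col col_mxKu col_mxKd rpredN hx; apply.
have /(_ (col_mx 0 v)) : forall w : 'cV[L]_(1 + m), w \is a mxOver B ->
    w \is a mxOver B /\ S (dsubmx w).
  apply: h => [w w' [? ?] [? ?]|b' w hb [? ?]|w hw|w [hw Sw]].
  - by rewrite linearD rpredD //; split=> //; apply: SD.
  - by rewrite linearZ mxOverZ //=; split=> //; apply: SZ.
  - move: hw; rewrite hGE !over_col !col_mxKu !col_mxKd => /andP[hu hd].
    rewrite hu mxOverM //; split=> //.
    by have := SG' 0 (dsubmx w) (o0 _ _) hd; rewrite mulmx0 add0r.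
  - rewrite hTE mxOverM //; split=> //; apply: SD; last exact: ST.
    move: hw; rewrite over_col => /andP[hu _].
    by have := SG' (usubmx w) 0 hu (o0 _ _); rewrite mulmx0 addr0.
by rewrite over_col col_mxKu !col_mxKd o0 hv => /(_ isT)[].
Qed.

(** Both widths reduce to the same number, so the cast of [row_mxA] is trivial. *)
Lemma row_mx1A (R : Type) p m r (A : 'M[R]_(p, 1)) (A' : 'M[R]_(p, m))
    (A'' : 'M[R]_(p, r)) :
  row_mx (row_mx A A') A'' = row_mx A (row_mx A' A'') :> 'M[R]_(p, 1 + (m + r)).
Proof.
rewrite row_mxA /=; symmetry; exact: (@castmx_id _ _ (1 + (m + r))).
Qed.

(** The pivot 1 clears the first row by column operations over B[X], one of them
    with coefficient X - a.  This frees the first column, whose remaining part - c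
    joins G in the smaller pencil. *)
Lemma trivial_pencil_block B m r (a : 'M[L]_1) b (c : 'M[L]_(m, 1)) (T : 'M[L]_m)
    (G : 'M[L]_(m, r)) :
  block_mx a b c T \is a mxOver B ->
  trivial_pencil B T (row_mx (- c) G) ->
  trivial_pencil B (block_mx a b c T) (block_mx (1%:M : 'M_1) 0 0 G).
Proof.
move=> hT [N [U [V [hU hV UV hN]]]].
pose xa : 'M[{poly L}]_1 := 'X%:M - cst_mx a.
(* the columns of the pencil are those of X - a, X - T, the pivot, and G; Q clears
   the first row with the pivot and moves the pivot to the front *)
pose Q : 'M_((1 + m) + (1 + r)) := block_mx (block_mx (0 : 'M_1) 0 0 1%:M) (block_mx 1%:M 0 0 0)
  (block_mx 1%:M (cst_mx b) 0 0) (block_mx (- xa) 0 0 1%:M).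
pose Q' : 'M_((1 + m) + (1 + r)) := block_mx (block_mx xa (- cst_mx b) 0 1%:M)
  (block_mx 1%:M 0 0 0) (block_mx 1%:M 0 0 0) (block_mx (0 : 'M_1) 0 0 1%:M).
have QQ' : Q *m Q' = 1%:M.
  rewrite /Q /Q' !mulmx_block !(mul0mx, mulmx0, mul1mx, mulmx1, addr0, add0r).
  rewrite !add_block_mx !(mul0mx, mulmx0, mul1mx, mulmx1, addr0, add0r).
  by rewrite addNr subrr -!scalar_mx_block !block_mx0 -scalar_mx_block.
have o0 p q : (0 : 'M_(p, q)) \is a mxOver (poly_ring B) by rewrite mxOver0 ?rpred0.
have o1 p : (1%:M : 'M_p) \is a mxOver (poly_ring B) by exact: mxOver1.
move: hT; rewrite !over_block_mx => /andP[/andP[ha hb] /andP[hc hT]].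
have hxa : xa \is a mxOver (poly_ring B).
  by rewrite rpredB ?cst_mx_over // mxOver_scalar ?rpred0 //; apply: polyOverX.
(* W is a block matrix of width 1 + (m + (1 + r)), which is convertible to the
   width (1 + m) + (1 + r) of Q *)
pose W : 'M_((1 + m) + (1 + r)) := block_mx (1%:M : 'M_1) 0 0 U.
pose W' : 'M_((1 + m) + (1 + r)) := block_mx (1%:M : 'M_1) 0 0 V.
have WW' : W *m W' = 1%:M.
  have := mulmx_block (1%:M : 'M_1) 0 0 U (1%:M : 'M_1) 0 0 V.
  rewrite !(mul0mx, mulmx0, mul1mx, mulmx1, addr0, add0r) UV -scalar_mx_block.
  exact.
have hW : W \is a mxOver (poly_ring B).
  by have : block_mx (1%:M : 'M_1) 0 0 U \is a mxOver (poly_ring B)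
    by rewrite !over_block_mx !o1 !o0.
have hW' : W' \is a mxOver (poly_ring B).
  by have : block_mx (1%:M : 'M_1) 0 0 V \is a mxOver (poly_ring B)
    by rewrite !over_block_mx !o1 !o0.
exists (block_mx (1%:M : 'M_1) 0 0 N).
exists (Q *m W), (W' *m Q'); split.
- by rewrite mxOverM // !over_block_mx rpredN !(o0, o1, hxa, cst_mx_over).
- by rewrite mxOverM // !over_block_mx rpredN !(o0, o1, hxa, cst_mx_over).
- by rewrite mulmxA -(mulmxA Q) WW' mulmx1.
have -> : cst_mx (block_mx (1%:M : 'M_1) 0 0 N) = block_mx 1%:M 0 0 (cst_mx N).
  by rewrite /cst_mx map_block_mx map_mx1 !map_mx0.
have -> : pencil 'X (cst_mx (block_mx a b c T)) (cst_mx (block_mx (1%:M : 'M_1) 0 0 G)) =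
  row_mx (block_mx xa (- cst_mx b) (- cst_mx c) ('X%:M - cst_mx T)) (block_mx 1%:M 0 0 (cst_mx G)).
  rewrite /pencil /cst_mx !map_block_mx map_mx1 !map_mx0; congr row_mx.
  by rewrite (scalar_mx_block _ _ 'X) opp_block_mx add_block_mx !add0r.
rewrite mulmxA /Q mul_row_block !mulmx_block.
rewrite !(mul0mx, mulmx0, mul1mx, mulmx1, addr0, add0r) !add_block_mx.
rewrite !(mul0mx, mulmx0, mul1mx, mulmx1, addr0, add0r) addNr subrr.
have -> : row_mx (block_mx 1%:M 0 0 ('X%:M - cst_mx T)) (block_mx (0 : 'M_1) 0 (- cst_mx c) (cst_mx G)) =
    block_mx (1%:M : 'M_1) 0 0 (pencil 'X (cst_mx T) (cst_mx (row_mx (- c) G))) :> 'M_(1 + m, 1 + (m + (1 + r))).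
  rewrite -block_mxEh /pencil {1}/block_mx !row_mx1A !row_mx0 block_mxEv.
  by rewrite /cst_mx map_row_mx map_mxN.
rewrite -[RHS]/(block_mx (1%:M : 'M_1) 0 0 (cst_mx N)).
have := mulmx_block (1%:M : 'M_1) 0 0 (pencil 'X (cst_mx T) (cst_mx (row_mx (- c) G)))
  (1%:M : 'M_1) 0 0 U.
by rewrite !(mul0mx, mulmx0, mul1mx, mulmx1, addr0, add0r) hN.
Qed.

(** The vectors with entries in J form a T-stable submodule containing the image
    of G, hence they are all vectors. *)
Lemma reachable_unit_ideal B m r (T : 'M[L]_m) (G : 'M[L]_(m, r)) (J : L -> Prop) :
    (0 < m)%N -> T \is a mxOver B -> reachable B T G ->
    J 0 -> (forall a b, J a -> J b -> J (a + b)) ->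
    (forall a b, b \in B -> J a -> J (b * a)) ->
    (forall i j, J (G i j)) ->
  J 1.
Proof.
move=> m0 hT h J0 JD JM JG.
have Jsum n (F : 'I_n -> L) : (forall i, J (F i)) -> J (\sum_i F i).
  by move=> hF; elim/big_ind: _ => // *; apply: JD.
suff H : forall v : 'cV[L]_m, v \is a mxOver B -> forall i j, J (v i j).
  have := H (const_mx 1) _ (Ordinal m0) 0; rewrite mxE; apply.
  exact/mxOver_const/rpred1.
apply: h => [v w hv hw i j|b v hb hv i j|v /mxOverP hv i j|v hv i j].
- by rewrite mxE; apply: JD.
- by rewrite mxE; apply: JM.
- by rewrite mxE; apply: Jsum => l; rewrite mulrC; apply: JM.
- by rewrite mxE; apply: Jsum => l; apply: JM; rewrite ?(mxOverP hT).
Qed.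

Lemma pivot_normal_form B m r (G : 'M[L]_(1 + m, 1 + r)) i j :
  G \is a mxOver B -> G i j != 0 -> (G i j)^-1 \in B ->
  exists P P' Q Q' (G' : 'M[L]_(m, r)),
    [/\ [/\ P \is a mxOver B, P' \is a mxOver B, Q \is a mxOver B & Q' \is a mxOver B],
        P *m P' = 1%:M, Q *m Q' = 1%:M & P *m G *m Q = block_mx (1%:M : 'M_1) 0 0 G'].
Proof.
move=> hG g0 hg; pose t n (k : 'I_(1 + n)) : 'M[L]_(1 + n) := tperm_mx k 0.
have tt n k : t n k *m t n k = 1%:M by rewrite /t -perm_mxM tperm2 perm_mx1.
have ht n k : t n k \is a mxOver B by apply/mxOverP => a b; rewrite !mxE rpred_nat.
have [G1 G1E] : exists G1, G1 = t _ i *m G *m t _ j by eexists.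
have hG1 : G1 \is a mxOver B by rewrite G1E !mxOverM.
have G100 : G1 0 0 = G i j by rewrite G1E -xrowE -xcolE !mxE !tpermR.
pose g := G i j; pose b := ursubmx G1; pose c := dlsubmx G1; pose d := drsubmx G1.
have E : G1 = block_mx g%:M b c d.
  rewrite -{1}(submxK G1); congr block_mx.
  apply/matrixP => a e; rewrite !ord1 !mxE eqxx mulr1n -[RHS]G100.
  by congr (G1 _ _); apply/val_inj.
move: hG1; rewrite E !over_block_mx => /andP[/andP[hgg hb] /andP[hc hd]].
pose P1 := block_mx (g^-1%:M : 'M_1) 0 (- g^-1 *: c) 1%:M.
pose P1' := block_mx (g%:M : 'M_1) 0 c 1%:M.
pose Q1 := block_mx (1%:M : 'M_1) (- g^-1 *: b) 0 1%:M.
pose Q1' := block_mx (1%:M : 'M_1) (g^-1 *: b) 0 1%:M.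
have gB : g \in B by rewrite (mxOverP hG).
have gVB : g^-1 \in B by [].
have gNB : - g^-1 \in B by rewrite rpredN.
have o0 p q : (0 : 'M_(p, q)) \is a mxOver B by rewrite mxOver0 ?rpred0.
have os p a : a \in B -> (a%:M : 'M_p) \is a mxOver B by move=> h; rewrite mxOver_scalar ?rpred0.
have hP1 : P1 \is a mxOver B by rewrite !over_block_mx !os ?rpred1 // !o0 ?mxOverZ.
have hP1' : P1' \is a mxOver B by rewrite !over_block_mx !os ?rpred1 // !o0 ?hb ?hc.
have hQ1 : Q1 \is a mxOver B by rewrite !over_block_mx !os ?rpred1 // !o0 ?mxOverZ.
have hQ1' : Q1' \is a mxOver B by rewrite !over_block_mx !os ?rpred1 // !o0 ?mxOverZ.
exists (P1 *m t _ i), (t _ i *m P1'), (t _ j *m Q1), (Q1' *m t _ j), (d - g^-1 *: (c *m b)).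
split; first by rewrite !mxOverM.
- rewrite mulmxA -(mulmxA P1) tt mulmx1 /P1 /P1' mulmx_block.
  rewrite !(mul0mx, mulmx0, mul1mx, mulmx1, addr0, add0r) -scalar_mxM mulVf //.
  by rewrite mul_mx_scalar scalerA mulrN mulfV // scaleN1r addNr -scalar_mx_block.
- rewrite mulmxA -(mulmxA (t _ j)) /Q1 /Q1' mulmx_block.
  rewrite !(mul0mx, mulmx0, mul1mx, mulmx1, addr0, add0r) scaleNr subrr.
  by rewrite -scalar_mx_block mulmx1 tt.
- have -> : P1 *m t m i *m G *m (t r j *m Q1) = P1 *m (t m i *m G *m t r j) *m Q1.
    by rewrite !mulmxA.
  rewrite -G1E E /P1 /Q1 !mulmx_block.
  rewrite !(mul0mx, mulmx0, mul1mx, mulmx1, addr0, add0r) -scalar_mxM mulVf //.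
  rewrite mul_mx_scalar scalerA mulrN mulfV // scaleN1r addNr mul1mx.
  rewrite mul0mx add0r mul_scalar_mx scaleNr addNr -scalemxAl scaleNr addrC.
  by rewrite (addrC d).
Qed.

End Pencil.

(** * Patching *)

Lemma uniform_bound (I : finType) (P : I -> nat -> Prop) :
  (forall i n n', (n <= n')%N -> P i n -> P i n') ->
  (forall i, exists n, P i n) -> exists n, forall i, P i n.
Proof.
move=> Pmono /choice[f hf]; exists (\max_i f i) => i.
exact: Pmono (leq_bigmax i) (hf i).
Qed.

Section Localization.
Variables (L : fieldType) (B : subringClosed L) (g : L).

(** The subring B[1/g] of L.  The membership proof is an argument because the
    predicate is a subring only when g is in B. *)
Definition localized of g \in B : {pred L} :=
  [pred y | `[< exists n, y * g ^+ n \in B >]].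

Hypothesis gB : g \in B.

Lemma localizedP y : reflect (exists n, y * g ^+ n \in B) (y \in localized gB).
Proof. exact: asboolP. Qed.

Lemma localized_subring : subring_closed (localized gB).
Proof.
have gX n : g ^+ n \in B by exact: rpredX.
split=> [|x y /localizedP[n hn] /localizedP[n' hn']|x y /localizedP[n hn] /localizedP[n' hn']]; apply/localizedP.
- by exists 0%N; rewrite mulr1 rpred1.
- exists (n + n')%N; rewrite exprD mulrBl rpredB //; first by rewrite mulrA rpredM.
  by rewrite (mulrC (g ^+ n)) mulrA rpredM.
- by exists (n + n')%N; rewrite exprD mulrACA rpredM.
Qed.

HB.instance Definition _ := GRing.isSubringClosed.Build L (localized gB) localized_subring.

Lemma sub_localized : {subset B <= localized gB}.
Proof. by move=> y hy; apply/localizedP; exists 0%N; rewrite mulr1. Qed.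

Lemma localized_inv : g != 0 -> g^-1 \in localized gB.
Proof. by move=> g0; apply/localizedP; exists 1%N; rewrite expr1 mulVf ?rpred1. Qed.

Lemma clear_denominators m q (U : 'M[{poly L}]_(m, q)) :
  U \is a mxOver (poly_ring (localized gB)) ->
  exists n, forall k, (n <= k)%N -> (g ^+ k)%:P *: U \is a mxOver (poly_ring B).
Proof.
move/mxOverP=> hU.
have gX n : g ^+ n \in B by exact: rpredX.
have mono y n n' : (n <= n')%N -> y * g ^+ n \in B -> y * g ^+ n' \in B.
  by move=> /subnKC <- h; rewrite exprD mulrA rpredM.
have [|ij|N hN] := @uniform_bound ('I_m * 'I_q)%type
    (fun ij n => forall l, (U ij.1 ij.2)`_l * g ^+ n \in B).
- by move=> ij n n' le h l; apply: mono le (h l).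
- set p := U _ _; have [|l|n hn] := @uniform_bound 'I_(size p) (fun l n => p`_l * g ^+ n \in B).
  + by move=> l n n'; apply: mono.
  + by apply/localizedP; have /polyOverP := hU ij.1 ij.2; apply.
  exists n => l; have [h|h] := ltnP l (size p); first exact: (hn (Ordinal h)).
  by rewrite nth_default // mul0r rpred0.
exists N => k le; apply/mxOverP => i j; rewrite mxE; apply/polyOverP => l.
by rewrite coefCM mulrC; apply: mono le (hN (i, j) l).
Qed.

End Localization.

Section Patching.
Variable L : fieldType.
Implicit Types (B : subringClosed L) (m r : nat).

(** (q(s + h) - q(s)) / h. *)
Definition diff_quot (s h q : {poly L}) : {poly L} :=
  \sum_(i < size q) q`_i *: \sum_(j < i) (s + h) ^+ (i.-1 - j) * s ^+ j.

Lemma diff_quotE s h q : q \Po (s + h) = q \Po s + h * diff_quot s h q.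
Proof.
rewrite [RHS]addrC; apply/eqP; rewrite -subr_eq; apply/eqP.
rewrite !comp_polyE -sumrB /diff_quot mulr_sumr; apply: eq_bigr => i _.
by rewrite -scalerBr -scalerAr subrXX addrAC subrr add0r.
Qed.

Lemma diff_quot_over B s h q : s \in poly_ring B -> h \in poly_ring B -> q \in poly_ring B ->
  diff_quot s h q \in poly_ring B.
Proof.
move=> hs hh /polyOverP hq; apply: rpred_sum => i _; apply: polyOverZ => //.
by apply: rpred_sum => j _; rewrite rpredM ?rpredX ?rpredD.
Qed.

Lemma comp_over B s q : s \in poly_ring B -> q \in poly_ring B -> q \Po s \in poly_ring B.
Proof. by move=> hs hq; apply: polyOver_comp. Qed.

Lemma pencil_map (R R' : comNzRingType) (f : {rmorphism R -> R'}) m r s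
    (T : 'M[R]_m) (G : 'M[R]_(m, r)) :
  map_mx f (pencil s T G) = pencil (f s) (map_mx f T) (map_mx f G).
Proof. by rewrite map_row_mx map_mxB map_scalar_mx. Qed.

(** Let M be the pencil and suppose that M(X) U(X) is constant, with U invertible
    over B[1/g].  Then M(s + h) V = M(s) for V = U(s + h) U(s)^-1.  Since
    U(s + h) - U(s) is divisible by h, the denominators of V - 1 are cancelled when
    h is a multiple of a large power of g.  That this power is independent of s and
    t is what allows the ideal argument in [reachable_trivial_pencil]. *)
Lemma patching B m r (T : 'M[L]_m) (G : 'M[L]_(m, r)) g (gB : g \in B) : g != 0 ->
  trivial_pencil (localized gB) T G ->
  exists n, forall s t, s \in poly_ring B -> t \in poly_ring B ->
    right_equiv (poly_ring B) (pencil (s + (g ^+ n)%:P * t) (cst_mx T) (cst_mx G))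
      (pencil s (cst_mx T) (cst_mx G)).
Proof.
move=> g0 [N [U [V [hU hV UV hN]]]].
have [n1 hn1] := clear_denominators hU; have [n2 hn2] := clear_denominators hV.
pose n := maxn n1 n2; pose c := g ^+ n.
have {}hn1 : c%:P *: U \is a mxOver (poly_ring B) by apply: hn1; apply: leq_maxl.
have {}hn2 : c%:P *: V \is a mxOver (poly_ring B) by apply: hn2; apply: leq_maxr.
have cB : c \in B by rewrite rpredX.
exists (n + n)%N => s t hs ht; rewrite exprD; set h := _ * t.
have hE : h = c%:P * c%:P * t by rewrite /h polyCM.
have hh : h \in poly_ring B by rewrite hE !rpredM // polyOverC.
pose at_ p q (p0 : {poly L}) (A : 'M[{poly L}]_(p, q)) := map_mx (comp_poly p0) A.
have at_cst p q p0 (A : 'M[L]_(p, q)) : at_ _ _ p0 (cst_mx A) = cst_mx A.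
  by apply/matrixP => i j; rewrite !mxE comp_polyC.
have at_pencil p0 : at_ _ _ p0 (pencil 'X (cst_mx T) (cst_mx G)) = pencil p0 (cst_mx T) (cst_mx G).
  by rewrite [LHS]pencil_map /= comp_polyX; congr pencil; apply: at_cst.
have at_over p q p0 (A : 'M_(p, q)) : p0 \in poly_ring B ->
    A \is a mxOver (poly_ring B) -> at_ _ _ p0 A \is a mxOver (poly_ring B).
  by move=> hp0 /mxOverP hA; apply/mxOverP => i j; rewrite mxE comp_over.
have atM p q q' p0 (A : 'M_(p, q)) (A' : 'M_(q, q')) :
  at_ _ _ p0 (A *m A') = at_ _ _ p0 A *m at_ _ _ p0 A' by exact: map_mxM.
have at1 p p0 : at_ _ _ p0 (1%:M : 'M_p) = 1%:M by exact: map_mx1.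
have atZ p q p0 (A : 'M_(p, q)) : at_ _ _ p0 (c%:P *: A) = c%:P *: at_ _ _ p0 A.
  by apply/matrixP => i j; rewrite !mxE rmorphM /= comp_polyC.
have c0 : c%:P != 0 by rewrite polyC_eq0 expf_neq0.
have D p q (A : 'M_(p, q)) : c%:P *: A \is a mxOver (poly_ring B) ->
    exists2 A', A' \is a mxOver (poly_ring B) &
      at_ _ _ (s + h) A = at_ _ _ s A + (c%:P * t) *: A'.
  move/mxOverP=> hA; exists (map_mx (diff_quot s h) (c%:P *: A)).
    by apply/mxOverP => i j; rewrite mxE diff_quot_over.
  apply/matrixP => i j; apply: (mulfI c0); rewrite !mxE.
  rewrite -{1}(comp_polyC c (s + h)) -rmorphM /= diff_quotE mulrDr rmorphM /= comp_polyC.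
  by rewrite hE !mulrA.
have [U' hU' UE] := D _ _ _ hn1; have [V' hV' VE] := D _ _ _ hn2.
exists (at_ _ _ (s + h) U *m at_ _ _ s V), (at_ _ _ s U *m at_ _ _ (s + h) V).
split.
- rewrite UE mulmxDl -atM UV at1 rpredD ?mxOver1 // -scalemxAl mulrC -scalerA.
  rewrite mxOverZ // scalemxAr -atZ mxOverM //.
  by rewrite at_over.
- rewrite VE mulmxDr -atM UV at1 rpredD ?mxOver1 // -scalemxAr mulrC -scalerA.
  rewrite mxOverZ // scalemxAl -atZ mxOverM //.
  by rewrite at_over.
- rewrite mulmxA -(mulmxA (at_ _ _ (s + h) U)) -atM (mulmx1C UV) at1 mulmx1.
  by rewrite -atM UV at1.
- rewrite -(at_pencil (s + h)) -(at_pencil s) mulmxA -atM hN at_cst -(at_cst _ _ s) -hN atM -mulmxA -atM.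
  by rewrite UV at1 mulmx1.
Qed.

Lemma pencil_step B m r (T : 'M[L]_(1 + m)) (G : 'M[L]_(1 + m, 1 + r)) i j :
    T \is a mxOver B -> G \is a mxOver B -> reachable B T G ->
    G i j != 0 -> (G i j)^-1 \in B ->
    (forall (T' : 'M[L]_m) (G' : 'M[L]_(m, 1 + r)),
       T' \is a mxOver B -> G' \is a mxOver B -> reachable B T' G' ->
       trivial_pencil B T' G') ->
  trivial_pencil B T G.
Proof.
move=> hT hG h g0 hg IH.
have [P [P' [Q [Q' [G' [[hP hP' hQ hQ'] PP' QQ' E]]]]]] := pivot_normal_form hG g0 hg.
have := reachable_change hP' hQ' PP' QQ' h; rewrite E => h'.
apply: (trivial_pencil_change hP hP' hQ hQ' PP' QQ'); rewrite E.
have hT' : P *m T *m P' \is a mxOver B by rewrite !mxOverM.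
have hG' : G' \is a mxOver B.
  have : P *m G *m Q \is a mxOver B by rewrite !mxOverM.
  by rewrite E !over_block_mx => /andP[_ /andP[]].
move: hT' h'; rewrite -(submxK (P *m T *m P')) => hT' h'.
apply: trivial_pencil_block => //; apply: IH.
- by move: hT'; rewrite !over_block_mx => /andP[_ /andP[]].
- move: hT'; rewrite !over_block_mx => /andP[_ /andP[hc _]].
  by rewrite rpredN hc hG'.
- exact: reachable_block h'.
Qed.

(** The b in B such that M(s + b t) is equivalent to M(s) for all s and t in B[X]
    form an ideal J.  By induction on m and patching, some power of every entry of
    G is in J; as these entries generate the unit ideal, 1 is in J.  Then s = 0 and
    t = X show that M(X) is equivalent to M(0). *)
Theorem reachable_trivial_pencil m r B (T : 'M[L]_m) (G : 'M[L]_(m, r)) :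
  T \is a mxOver B -> G \is a mxOver B -> reachable B T G -> trivial_pencil B T G.
Proof.
elim: m => [|m IH] in r B T G *.
  move=> _ _ _; exists 0; rewrite (_ : pencil _ _ _ = cst_mx 0); first exact: right_equiv_refl.
  by apply/matrixP => -[].
move=> hT hG h.
have loc_step i j (gB : G i j \in B) : G i j != 0 ->
    exists n, forall s t, s \in poly_ring B -> t \in poly_ring B ->
    right_equiv (poly_ring B) (pencil (s + (G i j ^+ n)%:P * t) (cst_mx T) (cst_mx G))
      (pencil s (cst_mx T) (cst_mx G)).
  move=> g0; apply: (patching (gB := gB)) => //.
  case: r => [|r] in G hG h i j gB g0 *; first by case: j gB g0.
  have sub := @sub_localized _ _ _ gB.
  apply: (@pencil_step _ _ _ _ _ i j) => //.
  - exact: mxOverS hT.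
  - exact: mxOverS hG.
  - exact: reachable_sub h.
  - exact: localized_inv.
  - by move=> T' G' *; apply: IH.
pose J b := b \in B /\ forall s t, s \in poly_ring B -> t \in poly_ring B ->
  right_equiv (poly_ring B) (pencil (s + b%:P * t) (cst_mx T) (cst_mx G)) (pencil s (cst_mx T) (cst_mx G)).
(* the radical of J *)
pose rad b := b \in B /\ exists n, J (b ^+ n).
have JD a b : J a -> J b -> J (a + b).
  move=> [ha Ja] [hb Jb]; split; first exact: rpredD.
  move=> s t hs ht; rewrite polyCD mulrDl addrA.
  apply: right_equiv_trans (Jb _ _ _ ht) _; last exact: Ja.
  by rewrite rpredD // rpredM // polyOverC.
have JM a b : b \in B -> J a -> J (b * a).
  move=> hb [ha Ja]; split; first exact: rpredM.
  move=> s t hs ht; rewrite (mulrC b) polyCM -mulrA; apply: Ja => //.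
  by rewrite rpredM // polyOverC.
have J0 : J 0.
  split; first exact: rpred0.
  by move=> s t _ _; rewrite mul0r addr0; apply: right_equiv_refl.
suff [_ [n []]] : rad 1.
  rewrite expr1n => _ /(_ 0 'X (rpred0 _) (polyOverX _)); rewrite mul1r add0r => H.
  exists (pencil 0 T G); apply: right_equiv_trans H _.
  have -> : pencil 0 (cst_mx T) (cst_mx G) = cst_mx (pencil 0 T G).
    by rewrite /cst_mx pencil_map /= polyC0.
  exact: right_equiv_refl.
apply: (reachable_unit_ideal (ltn0Sn m) hT h).
- by split; [exact: rpred0|exists 1%N; rewrite expr1].
- move=> a b [ha [n Jn]] [hb [n' Jn']]; split; first exact: rpredD.
  exists (n + n')%N; rewrite exprDn; elim/big_ind: _ => // i _.
  rewrite -mulrnAl -mulr_natl.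
  have [le|lt] := leqP n' i.
    have -> : b ^+ i = b ^+ (i - n') * b ^+ n' by rewrite -exprD subnK.
    by rewrite mulrA; apply: JM; rewrite ?rpredM ?rpredX ?rpred_nat.
  have le : (n <= n + n' - i)%N by rewrite -addnBA ?leq_addr // ltnW.
  have -> : a ^+ (n + n' - i) = a ^+ (n + n' - i - n) * a ^+ n by rewrite -exprD subnK.
  rewrite mulrC !mulrA.
  by apply: JM; rewrite // !rpredM ?rpredX ?rpred_nat.
- move=> a b hb [ha [n Jn]]; split; first exact: rpredM.
  by exists n; rewrite exprMn; apply: JM => //; apply: rpredX.
move=> i j; have gB : G i j \in B by rewrite (mxOverP hG).
split=> //; have [->|g0] := eqVneq (G i j) 0; first by exists 1%N; rewrite expr1.
have [n hn] := loc_step i j gB g0; exists n; split=> //.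
by rewrite rpredX.
Qed.

End Patching.

(** * Adjoining a transcendental element or its powers *)

Section Adjunction.
Variable L : fieldType.
Implicit Types (B : subringClosed L) (m r : nat) (x : L).

(** The subring B[x, 1/x] of L, or B[x] if [laurent] is false.  The condition
    a x^j = p(x), rather than a = p(x) / x^j, defines a subring even for x = 0. *)
Definition adjoin (laurent : bool) B x : {pred L} :=
  [pred a | `[< exists j p, [/\ laurent || (j == 0%N), p \in poly_ring B & a * x ^+ j = p.[x]] >]].

Lemma adjoinP laurent B x a :
  reflect (exists j p, [/\ laurent || (j == 0%N), p \in poly_ring B & a * x ^+ j = p.[x]])
    (a \in adjoin laurent B x).
Proof. exact: asboolP. Qed.

Lemma adjoin_subring laurent B x : subring_closed (adjoin laurent B x).
Proof.
have hX j : 'X^j \in poly_ring B by apply: polyOverXn.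
have hl j j' : laurent || (j == 0%N) -> laurent || (j' == 0%N) ->
    laurent || (j + j' == 0)%N.
  by case: laurent => //= /eqP-> /eqP->.
split=> [|a b /adjoinP[j [p [hj hp ap]]] /adjoinP[j' [q [hj' hq bq]]]
  |a b /adjoinP[j [p [hj hp ap]]] /adjoinP[j' [q [hj' hq bq]]]]; apply/adjoinP.
- by exists 0%N, 1; rewrite eqxx orbT rpred1 hornerC expr0 mulr1.
- exists (j + j')%N, (p * 'X^j' - q * 'X^j).
  split; rewrite ?hl ?rpredB ?rpredM //.
  by rewrite !hornerE -ap -bq exprD mulrBl mulrA (mulrC (x ^+ j)) mulrA.
- exists (j + j')%N, (p * q); split; rewrite ?hl ?rpredM //.
  by rewrite hornerM -ap -bq exprD mulrACA.
Qed.

HB.instance Definition _ laurent B x :=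
  GRing.isSubringClosed.Build L (adjoin laurent B x) (@adjoin_subring laurent B x).

Lemma adjoin_polyP B x a :
  reflect (exists2 p, p \in poly_ring B & a = p.[x]) (a \in adjoin false B x).
Proof.
apply: (iffP (adjoinP _ _ _ _)) => [[j [p [/eqP-> hp]]]|[p hp ->]].
  by rewrite mulr1; exists p.
by exists 0%N, p; rewrite mulr1.
Qed.

Lemma adjoin_poly_sub laurent B x : {subset adjoin false B x <= adjoin laurent B x}.
Proof.
move=> a /adjoin_polyP[p hp ->]; apply/adjoinP.
by exists 0%N, p; rewrite orbT mulr1.
Qed.

Lemma adjoin_base laurent B x : {subset B <= adjoin laurent B x}.
Proof.
move=> b hb; apply: adjoin_poly_sub; apply/adjoin_polyP.
by exists b%:P; rewrite ?hornerC ?polyOverC.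
Qed.

Lemma adjoin_var laurent B x : x \in adjoin laurent B x.
Proof.
apply: adjoin_poly_sub; apply/adjoin_polyP.
by exists 'X; rewrite ?hornerX // polyOverX.
Qed.

Lemma adjoin_inv B x : x != 0 -> x^-1 \in adjoin true B x.
Proof.
by move=> x0; apply/adjoinP; exists 1%N, 1; rewrite rpred1 hornerC mulVf.
Qed.

Definition transcendental B x : Prop :=
  forall p, p \in poly_ring B -> p.[x] = 0 -> p = 0.

Lemma transcendental_neq0 B x : transcendental B x -> x != 0.
Proof.
move=> tr; apply/eqP => x0.
have /(_ (polyOverX _)) := tr 'X; rewrite hornerX => /(_ x0)/eqP.
by rewrite polyX_eq0.
Qed.

Lemma adjoin_vec_lift B x r (w : 'cV[L]_r) : w \is a mxOver (adjoin false B x) ->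
  exists2 p : 'cV[{poly L}]_r, p \is a mxOver (poly_ring B) & w = map_mx (horner^~ x) p.
Proof.
move=> /mxOverP hw.
have /choice[f hf] i : exists p, p \in poly_ring B /\ w i 0 = p.[x].
  by have /adjoin_polyP[p hp e] := hw i 0; exists p.
exists (\col_i f i); first by apply/mxOverP => i j; rewrite mxE; case: (hf i).
by apply/matrixP => i j; rewrite !mxE ord1; case: (hf i).
Qed.

(** Horner's scheme: a polynomial vector is built from constant vectors by
    w |-> x w + b. *)
Lemma adjoin_vec_ind B x r (P : 'cV[L]_r -> Prop) :
    P 0 ->
    (forall w b, w \is a mxOver (adjoin false B x) -> b \is a mxOver B ->
       P w -> P (x *: w + b)) ->
  forall w, w \is a mxOver (adjoin false B x) -> P w.
Proof.
move=> P0 PS w /adjoin_vec_lift[p + ->]; move=> {w}.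
have [n] : exists n, forall i, (size (p i 0%R) <= n)%N.
  exists (\max_i size (p i 0%R)) => i.
  exact: (leq_bigmax (F := fun i => size (p i 0%R))).
elim: n p => [|n IH] p sp /mxOverP hp.
  suff -> : map_mx (horner^~ x) p = 0 by [].
  apply/matrixP => i j; rewrite !mxE ord1.
  have := sp i; rewrite leqn0 size_poly_eq0 => /eqP pi0.
  by rewrite pi0 horner0.
pose p' : 'cV_r := \col_i \poly_(l < n) (p i 0)`_l.+1.
pose b : 'cV_r := \col_i (p i 0)`_0.
have hp' : p' \is a mxOver (poly_ring B).
  apply/mxOverP => i j; rewrite mxE; apply: polyOver_poly => l _.
  by have /polyOverP := hp i 0; apply.
have pE : map_mx (horner^~ x) p = x *: map_mx (horner^~ x) p' + b.
  apply/matrixP => i j; rewrite !mxE ord1 mulrC -hornerMX.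
  rewrite -[X in _ + X](hornerC _ x) -hornerD; congr (_.[x]); apply/polyP => -[|l]; rewrite coefD coefMX coefC /= ?add0r // addr0 coef_poly.
  by case: ltnP => // h; rewrite nth_default // (leq_trans (sp i)).
rewrite pE; apply: PS; last by apply: IH => // i; rewrite mxE size_poly.
  apply/mxOverP => i j; rewrite mxE ord1; apply/adjoin_polyP.
  by exists (p' i 0) => //; apply: (mxOverP hp').
by apply/mxOverP => i j; rewrite mxE; have /polyOverP := hp i 0; apply.
Qed.

Lemma det_over (R : comNzRingType) (S : subringClosed R) n (M : 'M[R]_n) :
  M \is a mxOver S -> \det M \in S.
Proof.
move/mxOverP=> hM; apply: rpred_sum => s _; apply: rpredM.
  by rewrite rpredX // rpredN1.
by apply: rpred_prod.
Qed.

(** The determinant is the value at x of the characteristic polynomial, which is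
    monic with coefficients in B. *)
Lemma pencil_unitmx B x m (T : 'M[L]_m) : transcendental B x -> T \is a mxOver B ->
  x%:M - T \in unitmx.
Proof.
move=> tr hT; rewrite unitmxE unitfE; apply/eqP => det0.
have /eqP : char_poly T = 0.
  apply: tr; first apply: det_over.
    rewrite rpredB ?cst_mx_over // mxOver_scalar ?rpred0 //; exact: polyOverX.
  rewrite /char_poly -[LHS](det_map_mx (horner_eval x)) -[RHS]det0; congr (\det _).
  rewrite map_mxB map_scalar_mx /= /horner_eval hornerX; congr (_ - _).
  by apply/matrixP => i j; rewrite !mxE /= /horner_eval hornerC.
by rewrite (negPf (monic_neq0 (char_poly_monic T))).
Qed.

(** Look at the terms of highest degree in x: unless u = 0, the degree of x u is
    larger than that of T u and that of tau. *)
Lemma pencil_image_cst B x m (T : 'M[L]_m) (u tau : 'cV[L]_m) :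
    transcendental B x -> T \is a mxOver B ->
    u \is a mxOver (adjoin false B x) -> tau \is a mxOver B ->
  (x%:M - T) *m u = tau -> tau = 0.
Proof.
move=> tr hT /adjoin_vec_lift[p hp ->] htau.
set up := map_mx _ _ => E.
have {}E : ('X%:M - cst_mx T) *m p = cst_mx tau.
  apply/eqP; rewrite -subr_eq0; apply/eqP/matrixP => i j; rewrite [RHS]mxE; apply: tr.
    apply: (mxOverP (n := 1)); rewrite rpredB ?cst_mx_over // mxOverM //.
    by rewrite rpredB ?cst_mx_over // mxOver_scalar ?rpred0 //; exact: polyOverX.
  have evE (M : 'cV[{poly L}]_m) : (M i j).[x] = map_mx (horner_eval x) M i j by rewrite mxE.
  rewrite evE map_mxB map_mxM map_mxB map_scalar_mx /=.
  have ec p' q' (M : 'M[L]_(p', q')) : map_mx (horner_eval x) (cst_mx M) = M.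
    by apply/matrixP => ? ?; rewrite !mxE /= /horner_eval hornerC.
  by rewrite !ec /horner_eval hornerX E subrr mxE.
suff p0 : p = 0.
  by apply/matrixP => i j; move/matrixP/(_ i j): E; rewrite p0 mulmx0 !mxE => /esym/eqP;
    rewrite polyC_eq0 => /eqP.
have [n] : exists n, forall i, (size (p i 0%R) <= n)%N.
  exists (\max_i size (p i 0%R)) => i.
  exact: (leq_bigmax (F := fun i => size (p i 0%R))).
elim: n => [|n IH] sp.
  by apply/matrixP => i j; rewrite mxE ord1; apply/eqP; rewrite -size_poly_leq0.
apply: IH => i; apply/leq_sizeP => j; rewrite leq_eqVlt => /predU1P[<-|h]; last first.
  by rewrite nth_default // (leq_trans (sp i)).
move/matrixP/(_ i 0)/(congr1 (fun q : {poly L} => q`_n.+1)): E.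
rewrite mulmxBl mul_scalar_mx !mxE coefC /= coefB coefXM /= coef_sum big1 ?subr0 // => l _.
by rewrite !mxE coefCM nth_default ?mulr0.
Qed.

End Adjunction.

(** * Idempotent matrices over B[x] and B[x, 1/x] *)

Lemma columns_choice (R : Type) (S : {pred R}) m q (P : 'I_q -> 'cV[R]_m -> Prop) :
  (forall j, exists2 v, v \is a mxOver S & P j v) ->
  exists2 M : 'M[R]_(m, q), M \is a mxOver S & forall j, P j (col j M).
Proof.
move=> h.
have /choice[f hf] j : exists v, v \is a mxOver S /\ P j v by have [v ? ?] := h j; exists v.
exists (\matrix_(i, j) f j i 0).
  by apply/mxOverP => i j; rewrite mxE; have [/mxOverP] := hf j.
move=> j; suff -> : col j (\matrix_(i, j) f j i 0) = f j by case: (hf j).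
by apply/matrixP => i k; rewrite !mxE ord1.
Qed.

Lemma col_over (R : Type) (S : {pred R}) m q j (M : 'M[R]_(m, q)) :
  M \is a mxOver S -> col j M \is a mxOver S.
Proof. by move/mxOverP=> h; apply/mxOverP => i k; rewrite mxE. Qed.

Lemma eq_cols (R : Type) m q (M N : 'M[R]_(m, q)) :
  (forall j, col j M = col j N) -> M = N.
Proof.
by move=> h; apply/matrixP => i j; move/matrixP/(_ i 0): (h j); rewrite !mxE.
Qed.

Lemma col_mul (R : pzRingType) m n q j (M : 'M[R]_(m, n)) (N : 'M[R]_(n, q)) :
  col j (M *m N) = M *m col j N.
Proof. by rewrite !colE mulmxA. Qed.

(** For S a subring of R, every finite projective S-module is free: it is the image
    of an idempotent matrix E, and a basis gives E = U V with V U = 1. *)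
Definition projective_free (R : pzRingType) (S : {pred R}) : Prop :=
  forall n (E : 'M[R]_n), E \is a mxOver S -> E *m E = E ->
  exists r (U : 'M[R]_(n, r)) (V : 'M[R]_(r, n)),
    [/\ U \is a mxOver S, V \is a mxOver S, U *m V = E & V *m U = 1%:M].

Section Division.
Variables (L : fieldType) (B A : subringClosed L) (D : L) (d : nat) (xi : 'rV[L]_d).
Hypothesis div_exists : forall a, a \in A ->
  exists q (c : 'cV_d), [/\ q \in A, c \is a mxOver B & a%:M = (D * q)%:M + xi *m c].
Hypothesis div_unique : forall q (c : 'cV_d), q \in A -> c \is a mxOver B ->
  (D * q)%:M + xi *m c = 0 -> c = 0.

(** Division by D with remainder in the B-span of the x^j, coordinate by
    coordinate.  The columns of Xi are the vectors x^j e_i. *)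
Lemma vector_division (C : subringClosed L) r : xi \is a mxOver C ->
  exists n (Xi : 'M[L]_(r, n)), [/\ Xi \is a mxOver C,
   forall q (K : 'M_(r, q)), K \is a mxOver A -> exists Q c,
     [/\ Q \is a mxOver A, c \is a mxOver B & K = D *: Q + Xi *m c] &
   forall q (Q : 'M_(r, q)) c, Q \is a mxOver A -> c \is a mxOver B ->
     D *: Q + Xi *m c = 0 -> c = 0].
Proof.
move=> hxi.
suff [n [Xi [hXi ex un]]] : exists n (Xi : 'M[L]_(r, n)), [/\ Xi \is a mxOver C,
   forall K : 'cV_r, K \is a mxOver A -> exists Q c,
     [/\ Q \is a mxOver A, c \is a mxOver B & K = D *: Q + Xi *m c] &
   forall (Q : 'cV_r) c, Q \is a mxOver A -> c \is a mxOver B ->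
     D *: Q + Xi *m c = 0 -> c = 0].
  exists n, Xi; split=> // q.
    move=> K hK.
    have [|c hc hKc] := @columns_choice _ B _ q (fun j c => exists2 Q, Q \is a mxOver A &
        col j K = D *: Q + Xi *m c).
      by move=> j; have [Q [c [? ? ?]]] := ex _ (col_over j hK); exists c => //; exists Q.
    have [|Q hQ hKQ] := @columns_choice _ A _ q (fun j Q => col j K = D *: Q + Xi *m col j c).
      by move=> j; have [Q ? ?] := hKc j; exists Q.
    exists Q, c; split=> //; apply: eq_cols => j.
    by rewrite hKQ linearD linearZ /= col_mul.
  move=> Q c hQ hc E; apply: eq_cols => j; rewrite [RHS]raddf0.
  apply: (un (col j Q)); rewrite ?col_over //.
  by rewrite -col_mul -linearZ -linearD E raddf0.
elim: r => [|r [n [Xi [hXi ex un]]]].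
  exists 0%N, 0; split; first by apply/mxOverP => -[].
    move=> K _; exists 0, 0; split; try by apply/mxOverP => -[].
    by apply/matrixP => -[].
  by move=> Q c _ _ _; apply/matrixP => -[].
rewrite -[r.+1]/(1 + r)%N; exists (d + n)%N, (block_mx xi 0 0 Xi); split.
- by rewrite !over_block_mx hxi hXi !mxOver0 ?rpred0.
- move=> K; rewrite -(vsubmxK K) over_col_mx => /andP[h1 h2].
  have [Q [c [hQ hc E]]] := ex _ h2.
  have [|q [c' [hq hc' E']]] := div_exists (a := usubmx K 0 0).
    exact: (mxOverP h1).
  exists (col_mx q%:M Q), (col_mx c' c); split.
  + by rewrite over_col_mx hQ mxOver_scalar ?rpred0.
  + by rewrite over_col_mx hc hc'.
  + rewrite scale_col_mx mul_block_col !mul0mx addr0 add0r add_col_mx -E.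
    by rewrite scale_scalar_mx -E' -mx11_scalar.
- move=> Q c; rewrite -(vsubmxK Q) -(vsubmxK c) !over_col_mx.
  move=> /andP[h1 h2] /andP[h3 h4].
  rewrite scale_col_mx mul_block_col !mul0mx addr0 add0r add_col_mx.
  move/eqP; rewrite col_mx_eq0 => /andP[/eqP E1 /eqP E2].
  rewrite (un _ _ h2 h4 E2) (div_unique (q := usubmx Q 0 0) _ h3) ?col_mx0 //.
    exact: (mxOverP h1).
  by rewrite -scale_scalar_mx -mx11_scalar.
Qed.

End Division.

(** Over the field L, W / f and W' / f split E, where f^2 = D.  The lattice W A^n
    lies between D A^r and A^r and is isomorphic to E A^n.  The row xi lists the
    powers x^j spanning the remainders modulo D. *)
Section LatticeBasis.
Variables (L : fieldType) (B A : subringClosed L) (x D : L).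
Variables (d : nat) (xi : 'rV[L]_d).
Local Notation C := (adjoin false B x).
Hypotheses (tr : transcendental B x) (freeB : projective_free B).
Hypotheses (CA : {subset C <= A}) (D0 : D != 0).
Hypothesis Adenom : forall n (w : 'cV_n), w \is a mxOver A ->
  exists j, x ^- j \in A /\ x ^+ j *: w \is a mxOver C.
Hypothesis xiC : xi \is a mxOver C.
Hypothesis div_exists : forall a, a \in A ->
  exists q (c : 'cV_d), [/\ q \in A, c \is a mxOver B & a%:M = (D * q)%:M + xi *m c].
Hypothesis div_unique : forall q (c : 'cV_d), q \in A -> c \is a mxOver B ->
  (D * q)%:M + xi *m c = 0 -> c = 0.
Variables (n r : nat) (E : 'M[L]_n) (W : 'M[L]_(r, n)) (W' : 'M[L]_(n, r)).
Hypotheses (EA : E \is a mxOver A) (WA : W \is a mxOver A) (W'A : W' \is a mxOver A).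
Hypotheses (WW' : W *m W' = D%:M) (W'W : W' *m W = D *: E).

Let WE : W *m E = W.
Proof.
have : D *: (W *m E) = D *: W by rewrite scalemxAr -W'W mulmxA WW' mul_scalar_mx.
by move/(congr1 ( *:%R D^-1)); rewrite !scalerA mulVf // !scale1r.
Qed.

Let BC : {subset B <= C}. Proof. exact: adjoin_base. Qed.
Let BA : {subset B <= A}. Proof. by move=> b /BC/CA. Qed.
Let CmA p q (M : 'M[L]_(p, q)) : M \is a mxOver C -> M \is a mxOver A.
Proof. exact: (mxOverS CA). Qed.
Let BmA p q (M : 'M[L]_(p, q)) : M \is a mxOver B -> M \is a mxOver A.
Proof. exact: (mxOverS BA). Qed.
Let BmC p q (M : 'M[L]_(p, q)) : M \is a mxOver B -> M \is a mxOver C.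
Proof. exact: (mxOverS BC). Qed.

(** The quotient A^r / W A^n is B-free, with basis the columns of Phi.  Write
    q(a) for the B-linear quotient of a by D.  The map w |-> W q(W' w) is a B-linear
    projection of A^r onto W A^n, because W' W a = D E a and q(D E a) = E a; and it
    preserves D A^r.  So it induces a projection of the B-free module (A / D A)^r,
    whose complement P is idempotent over B and has the quotient as its image. *)
Lemma lattice_quotient_free : exists m (Phi : 'M[L]_(r, m)),
  [/\ Phi \is a mxOver C,
    forall q (w : 'M_(r, q)), w \is a mxOver A -> exists tau a,
      [/\ tau \is a mxOver B, a \is a mxOver A & w = Phi *m tau + W *m a] &
    forall q (tau : 'M_(m, q)) a, tau \is a mxOver B -> a \is a mxOver A ->
      Phi *m tau = W *m a -> tau = 0].
Proof.
have [n' [Xi [hXi ex un]]] := vector_division div_exists div_unique r xiC.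
have [nN [XiN [hXiN exN unN]]] := vector_division div_exists div_unique n xiC.
(* W q1 is the image of Xi under the projection onto the lattice *)
have [|q1 [c1 [hq1 hc1 E1]]] := exN _ (W' *m Xi); first by rewrite mxOverM // CmA.
have [|q2 [P [hq2 hP E2]]] := ex _ (Xi - W *m q1).
  by apply: rpredB; [exact: CmA|rewrite mxOverM].
have XiP : Xi - Xi *m P = W *m (q1 + W' *m q2).
  rewrite mulmxDr mulmxA WW' mul_scalar_mx; apply/eqP.
  by rewrite subr_eq -addrA -E2 [eqbRHS]addrC subrK.
(* P kills the remainders that lie in the lattice *)
have kerP q c (a : 'M_(n, q)) : c \is a mxOver B -> a \is a mxOver A ->
    Xi *m c = W *m a -> P *m c = 0.
  move=> hc ha e.
  have e1 : D *: (q1 *m c - E *m a) + XiN *m (c1 *m c) = 0.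
    rewrite scalerBr !scalemxAl -W'W -(mulmxA W') -e addrAC !mulmxA -mulmxDl.
    by rewrite -E1 subrr.
  have c1c : c1 *m c = 0.
    by apply: (unN _ _ _ _ _ e1); [rewrite rpredB ?mxOverM // BmA|rewrite mxOverM].
  rewrite c1c in e1.
  have {}e1 : q1 *m c = E *m a.
    move: e1; rewrite mulmx0 addr0 => /(congr1 ( *:%R D^-1)).
    rewrite scalerA mulVf // scale1r scaler0 => /eqP.
    by rewrite subr_eq0 => /eqP.
  apply: (un _ (q2 *m c)); first by rewrite mxOverM // BmA.
    by rewrite mxOverM.
  rewrite scalemxAl mulmxA -mulmxDl -E2 mulmxBl -mulmxA e1 mulmxA WE e subrr //.
have PP : P *m P = P.
  have := kerP _ (1%:M - P) (q1 + W' *m q2); rewrite !mulmxBr !mulmx1 => /(_ _ _ XiP).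
  rewrite rpredB ?mxOver1 // => /(_ isT).
  by rewrite rpredD ?mxOverM // => /(_ isT)/eqP; rewrite subr_eq0 => /eqP.
have [m [U [V [hU hV UV VU]]]] := freeB hP PP.
exists m, (Xi *m U); split.
- by rewrite mxOverM // BmC.
- move=> q w /ex[Q [c [hQ hc ->]]].
  exists (V *m c), (W' *m Q + (q1 + W' *m q2) *m c); split.
  + by rewrite mxOverM.
  + by rewrite !(rpredD, mxOverM) // BmA.
  + rewrite mulmxDr !mulmxA WW' mul_scalar_mx -XiP -(mulmxA Xi) UV mulmxBl.
    rewrite [RHS]addrCA; congr (_ + _); by rewrite addrC subrK.
- move=> q tau a htau ha; rewrite -mulmxA => e.
  have := kerP _ _ _ _ ha e; rewrite mxOverM // => /(_ isT) /(congr1 (mulmx V)).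
  by rewrite -UV !mulmxA VU mul1mx VU mul1mx mulmx0.
Qed.

(** The lattice W A^n has a basis, the columns of Z, and Y gives the coordinates.
    Let T be the action of x on the quotient B^m and G the class of the constant
    vectors.  Division by x - T ([divT]) shows that a polynomial vector z is in the
    lattice if and only if G z is in the image of x - T, that is, if z is the lower
    part of a vector of the kernel of [x - T | G].  As the pencil is trivial, that kernel
    is Ux times the kernel of the constant matrix N, which is free by the hypothesis
    on B because N has a right inverse over B. *)
Lemma split_idempotent_adjoin : exists r' (U : 'M[L]_(n, r')) (V : 'M[L]_(r', n)),
  [/\ U \is a mxOver A, V \is a mxOver A, U *m V = E & V *m U = 1%:M].
Proof.
have x0 := transcendental_neq0 tr.
have xC : x \in C by apply: adjoin_var.
have xA : x \in A by apply: CA.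
have o0 (S : subringClosed L) p q : (0 : 'M_(p, q)) \is a mxOver S by rewrite mxOver0 ?rpred0.
have [m [Phi [hPhi ex un]]] := lattice_quotient_free.
have [|T [aT [hT haT ET]]] := ex _ (x *: Phi); first by rewrite mxOverZ // CmA.
have [|G [aG [hG haG EG]]] := ex _ 1%:M; first exact: mxOver1.
(* one step of division by x - T *)
have next z tau a : z = Phi *m tau + W *m a -> forall b,
    x *: z + b = Phi *m (T *m tau + G *m b) + W *m (x *: a + aT *m tau + aG *m b) :> 'cV_r.
  move=> -> b; rewrite scalerDr scalemxAl ET -{1}[b]mul1mx EG !mulmxDl !mulmxDr -!scalemxAr.
  by rewrite !mulmxA -[X in X + _]addrA addrACA (addrC (W *m aT *m tau)).
have next_over tau a b : tau \is a mxOver B -> a \is a mxOver A -> b \is a mxOver B ->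
    (T *m tau + G *m b \is a mxOver B) * (x *: a + aT *m tau + aG *m b \is a mxOver A) :> Prop.
  move=> htau ha hb; split; first by rewrite rpredD // mxOverM.
  have hbA := BmA hb; have htA := BmA htau.
  by rewrite !rpredD ?mxOverZ ?mxOverM.
have divT : forall z : 'cV_r, z \is a mxOver C -> exists u tau a,
    [/\ u \is a mxOver C, tau \is a mxOver B, a \is a mxOver A,
        G *m z = (x%:M - T) *m u + tau & z = Phi *m tau + W *m a].
  apply: adjoin_vec_ind.
    by exists 0, 0, 0; rewrite !o0 !mulmx0 !addr0.
  move=> w b hw hb [u [tau [a [hu htau ha Eu Ew]]]].
  have [h1 h2] := next_over _ _ _ _ htau ha hb.
  exists (x *: u + tau), (T *m tau + G *m b), (x *: a + aT *m tau + aG *m b).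
  split=> //; last exact: next.
    by rewrite rpredD ?mxOverZ // BmC.
  rewrite mulmxDr -scalemxAr Eu scalerDr mulmxDr -scalemxAr.
  rewrite [(_ - _) *m tau]mulmxBl mul_scalar_mx -!addrA; congr (_ + _).
  by congr (_ + _); rewrite addKr.
have reach : reachable B T G.
  move=> S SD SZ SG ST.
  have S0 : S 0 by rewrite -(mulmx0 _ G); apply: SG.
  have H : forall z : 'cV_r, z \is a mxOver C -> exists tau a,
      [/\ S tau, tau \is a mxOver B, a \is a mxOver A & z = Phi *m tau + W *m a].
    apply: adjoin_vec_ind; first by exists 0, 0; rewrite !o0 !mulmx0 addr0.
    move=> w b hw hb [tau [a [Stau htau ha Ew]]].
    have [h1 h2] := next_over _ _ _ _ htau ha hb.
    exists (T *m tau + G *m b), (x *: a + aT *m tau + aG *m b); split=> //.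
      by apply: SD; [exact: ST|exact: SG].
    exact: next.
  move=> tau htau; have [|tau' [a [Stau' htau' ha e]]] := H (Phi *m tau).
    by rewrite mxOverM // BmC.
  suff /eqP : tau - tau' = 0 by rewrite subr_eq0 => /eqP->.
  by apply: (un _ _ a); rewrite ?rpredB // mulmxBr e addrC addKr.
have [N [U [Ui [hU hUi UUi hN]]]] := reachable_trivial_pencil hT hG reach.
pose at_ p q y (M : 'M[{poly L}]_(p, q)) := map_mx (horner_eval y) M.
have at_cst p q y (M : 'M[L]_(p, q)) : at_ _ _ y (cst_mx M) = M.
  by apply/matrixP => i j; rewrite !mxE /= /horner_eval hornerC.
have at_pencil y : at_ _ _ y (pencil 'X (cst_mx T) (cst_mx G)) = pencil y T G.
  by rewrite [LHS]pencil_map /= /horner_eval hornerX; congr pencil; apply: at_cst.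
have at_eq y : pencil y T G *m at_ _ _ y U = N.
  by rewrite -at_pencil -map_mxM hN; apply: at_cst.
have at_inv y : at_ _ _ y U *m at_ _ _ y Ui = 1%:M by rewrite -map_mxM UUi map_mx1.
have at_over p q y (S : subringClosed L) (M : 'M_(p, q)) : {subset B <= S} -> y \in S ->
    M \is a mxOver (poly_ring B) -> at_ _ _ y M \is a mxOver S.
  move=> sBS hy /mxOverP hM; apply/mxOverP => i j; rewrite mxE /horner_eval.
  by apply: rpred_horner => //; apply: polyOverS (hM i j).
have hN0 : N \is a mxOver B.
  rewrite -(at_eq 0) mxOverM // ?at_over ?rpred0 //.
  by rewrite over_row_mx rpredB // mxOver_scalar ?rpred0.
(* N has the same image as [- T | G], since U is invertible at 0; that image is
   T-stable and contains the image of G *)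
have [Y0 hY0 NY0] : exists2 Y0, Y0 \is a mxOver B & N *m Y0 = 1%:M.
  have img : forall v : 'cV_m, v \is a mxOver B ->
      exists2 y, y \is a mxOver B & pencil 0 T G *m y = v.
    apply: reach.
    - move=> v w [y hy <-] [y' hy' <-]; exists (y + y'); first exact: rpredD.
      by rewrite mulmxDr.
    - move=> b v hb [y hy <-]; exists (b *: y); first exact: mxOverZ.
      by rewrite scalemxAr.
    - move=> v hv; exists (col_mx 0 v); first by rewrite over_col_mx o0.
      by rewrite mul_row_col mulmx0 add0r.
    - move=> v [y hy <-]; set w := pencil 0 T G *m y.
      have hw : w \is a mxOver B.
        by rewrite mxOverM // over_row_mx rpredB // mxOver_scalar ?rpred0.
      exists (col_mx (- w) 0); first by rewrite over_col_mx rpredN hw o0.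
      by rewrite mul_row_col mulmx0 addr0 raddf0 sub0r mulNmx mulmxN opprK.
  have [Y hY EY] := @columns_choice _ B _ _ (fun j y => pencil 0 T G *m y = col j 1%:M)
    (fun j => img _ (col_over j (mxOver1 _ _))).
  exists (at_ _ _ 0 Ui *m Y); first by rewrite mxOverM // at_over ?rpred0.
  rewrite -(at_eq 0) mulmxA -(mulmxA (pencil 0 T G)) at_inv mulmx1.
  by apply: eq_cols => j; rewrite col_mul.
(* 1 - Y0 N projects onto the kernel of N *)
have idem : (1%:M - Y0 *m N) *m (1%:M - Y0 *m N) = 1%:M - Y0 *m N.
  rewrite mulmxBr mulmx1 mulmxBl mul1mx -(mulmxA Y0) (mulmxA N) NY0 mul1mx.
  by rewrite subrr subr0.
have [|r' [U1 [V1 [hU1 hV1 UV1 VU1]]]] := freeB _ idem.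
  by rewrite rpredB ?mxOver1 ?mxOverM.
have NU1 : N *m U1 = 0.
  by rewrite -(mulmx1 U1) -VU1 mulmxA UV1 mulmxA mulmxBr mulmx1 mulmxA NY0 mul1mx subrr mul0mx.
pose Ux := at_ _ _ x U; pose Uix := at_ _ _ x Ui.
have hUx : Ux \is a mxOver C by apply: at_over.
have hUix : Uix \is a mxOver C by apply: at_over.
pose k := Ux *m U1; pose Z := dsubmx k.
have Mk : pencil x T G *m k = 0 by rewrite /k mulmxA at_eq.
have hk : k \is a mxOver C by rewrite mxOverM // BmC.
have kE : (x%:M - T) *m usubmx k + G *m Z = 0 by rewrite -mul_row_col vsubmxK.
have unitT := pencil_unitmx tr hT.
(* over L, the lower part of a vector of the kernel of the pencil determines it *)
pose H := col_mx (- (invmx (x%:M - T) *m G)) 1%:M.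
have MH : pencil x T G *m H = 0.
  by rewrite mul_row_col mulmxN mulKVmx // mulmx1 addNr.
have HZ : H *m Z = k.
  rewrite mul_col_mx mul1mx mulNmx -mulmxA.
  have -> : G *m Z = - ((x%:M - T) *m usubmx k) by apply/eqP; rewrite -addr_eq0 addrC kE.
  by rewrite mulmxN mulKmx // opprK vsubmxK.
pose Y := V1 *m Uix *m H.
have NUix : N *m Uix = pencil x T G by rewrite -(at_eq x) -mulmxA at_inv mulmx1.
have ZY : Z *m Y = 1%:M.
  have -> : Z *m Y = dsubmx (k *m Y).
    by rewrite -[k in RHS]vsubmxK mul_col_mx col_mxKd.
  have -> : k *m Y = H.
    rewrite /k /Y !mulmxA -(mulmxA Ux) UV1 mulmxBr mulmx1 !mulmxBl at_inv mul1mx.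
    by rewrite -!(mulmxA _ _ H) -!mulmxA (mulmxA N) NUix MH !mulmx0 subr0.
  by rewrite col_mxKd.
have YZ : Y *m Z = 1%:M.
  by rewrite /Y -mulmxA HZ /k mulmxA -(mulmxA V1) (mulmx1C (at_inv x)) mulmx1.
have [aZ haZ ZE] : exists2 aZ, aZ \is a mxOver A & Z = W *m aZ.
  have [j|aZ haZ ZE] := @columns_choice _ A _ r' (fun j a => col j Z = W *m a).
    have hz : col j Z \is a mxOver C.
      by apply: col_over; move: hk; rewrite over_col => /andP[].
    have hu : col j (usubmx k) \is a mxOver C.
      by apply: col_over; move: hk; rewrite over_col => /andP[].
    have [u [tau [a [hu' htau ha Eu Ez]]]] := divT _ hz; exists a => //.
    suff tau0 : - tau = 0 by rewrite Ez -(opprK tau) tau0 oppr0 mulmx0 add0r.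
    apply: (pencil_image_cst (u := u + col j (usubmx k)) tr hT); rewrite ?rpredD ?rpredN //.
    have := congr1 (col j) kE; rewrite linearD /= !col_mul Eu raddf0 addrA -mulmxDr => e.
    by apply/eqP; rewrite -addr_eq0 addrC [_ + u]addrC in e *; rewrite addrC e.
  by exists aZ => //; apply: eq_cols => j; rewrite ZE col_mul.
have hYW : Y *m W \is a mxOver A.
  suff hcol j : Y *m col j W \is a mxOver A.
    apply/mxOverP => i j; have /mxOverP/(_ i 0) := hcol j.
    by rewrite -col_mul mxE.
  set w := col j W; have [J [hJ hxw]] := Adenom (col_over j WA).
  (* x^J w is a polynomial vector of the lattice, so it has remainder 0 *)
  have [u [tau [a [hu htau ha Eu Ez]]]] := divT _ hxw.
  have tau0 : tau = 0.
    apply: (un _ _ (x ^+ J *: delta_mx j 0 - a)) => //.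
      rewrite rpredB // mxOverZ ?rpredX //.
      by apply/mxOverP => i l; rewrite mxE rpred_nat.
    rewrite mulmxBr -scalemxAr -colE -/w; apply/eqP; rewrite eq_sym subr_eq.
    by apply/eqP; rewrite -Ez.
  have Hw : H *m (x ^+ J *: w) = col_mx (- u) (x ^+ J *: w).
    by rewrite mul_col_mx mul1mx mulNmx -mulmxA Eu tau0 addr0 mulKmx.
  have -> : Y *m w = x ^- J *: (V1 *m Uix *m (H *m (x ^+ J *: w))).
    by rewrite mulmxA -scalemxAr scalerA mulVf ?expf_neq0 // scale1r.
  rewrite mxOverZ // Hw mxOverM //; last first.
    by apply: CmA; rewrite over_col_mx rpredN hu.
  by rewrite mxOverM // CmA // BmC.
exists r', (D^-1 *: (W' *m Z)), (Y *m W); split=> //.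
- by rewrite ZE mulmxA W'W -scalemxAl scalerA mulVf // scale1r mxOverM.
- by rewrite -scalemxAl mulmxA -(mulmxA W') ZY mulmx1 W'W scalerA mulVf // scale1r.
- rewrite -scalemxAr mulmxA -(mulmxA Y) WW' mul_mx_scalar -scalemxAl YZ scalerA.
  by rewrite mulVf // scale1r.
Qed.

End LatticeBasis.

(** * Subfields and their rational functions *)

(** Rank factorization E = C R; the factors have full rank, so they cancel in
    C R C R = C R. *)
Lemma field_split (F : fieldType) n (E : 'M[F]_n) : E *m E = E ->
  exists r (U : 'M[F]_(n, r)) (V : 'M[F]_(r, n)), U *m V = E /\ V *m U = 1%:M.
Proof.
move=> EE; exists (\rank E), (col_base E), (row_base E); split; first exact: mulmx_base.
apply: (row_full_inj (col_base_full E)); apply: (row_free_inj (row_base_free E)).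
by rewrite mulmx1 mulmxA mulmx_base -mulmxA mulmx_base.
Qed.

Section Subfield.
Variables (L : fieldType) (k : divringClosed L).

(** The predicate k as a field of its own, over which rank factorization is
    available. *)
Record subfield : predArgType := Subfield { sfval : L; sfvalP : sfval \in k }.

HB.instance Definition _ := [isSub for sfval].
HB.instance Definition _ := [Choice of subfield by <:].
HB.instance Definition _ := [SubChoice_isSubIntegralDomain of subfield by <:].
HB.instance Definition _ := [SubIntegralDomain_isSubField of subfield by <:].

Lemma subfield_free : projective_free k.
Proof.
move=> n E /mxOverP hE EE.
pose E' := \matrix_(i, j) Subfield (hE i j).
have E'E : map_mx val E' = E by apply/matrixP => i j; rewrite !mxE.
have [|r [U [V [UV VU]]]] := @field_split _ _ E'.
  by apply: (map_mx_inj (f := val)); rewrite map_mxM E'E EE.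
exists r, (map_mx val U), (map_mx val V); split.
- by apply/mxOverP => i j; rewrite mxE sfvalP.
- by apply/mxOverP => i j; rewrite mxE sfvalP.
- by rewrite -map_mxM UV.
- by rewrite -map_mxM VU map_mx1.
Qed.

End Subfield.

Section FractionField.
Variable L : fieldType.
Implicit Types (k : divringClosed L) (x : L).

(** The subfield k(x) of L. *)
Definition frac_adjoin k x : {pred L} :=
  [pred a | `[< exists p q, [/\ p \in poly_ring k, q \in poly_ring k, q.[x] != 0 & a * q.[x] = p.[x]] >]].

Lemma frac_adjoinP k x a :
  reflect (exists p q, [/\ p \in poly_ring k, q \in poly_ring k, q.[x] != 0 & a * q.[x] = p.[x]])
    (a \in frac_adjoin k x).
Proof. exact: asboolP. Qed.

Lemma frac_adjoin_divring k x : divring_closed (frac_adjoin k x).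
Proof.
split=> [|a b /frac_adjoinP[p [q [hp hq q0 e]]] /frac_adjoinP[p' [q' [hp' hq' q0' e']]]
  |a b /frac_adjoinP[p [q [hp hq q0 e]]] /frac_adjoinP[p' [q' [hp' hq' q0' e']]]];
  apply/frac_adjoinP.
- by exists 1, 1; rewrite rpred1 hornerC oner_neq0 mulr1.
- exists (p * q' - p' * q), (q * q').
  rewrite rpredB ?rpredM // hornerD hornerN !hornerM -e -e' mulf_neq0 //; split=> //.
  by rewrite mulrBl mulrA -[b * _ * _]mulrA [q'.[x] * q.[x]]mulrC.
- have [b0|b0] := eqVneq b 0.
    by exists 0, 1; rewrite rpred0 rpred1 !hornerC oner_neq0 b0 invr0 mulr0 mul0r.
  exists (p * q'), (q * p'); rewrite !rpredM // !hornerM -e -e' !mulf_neq0 //.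
  split=> //; rewrite -!mulrA; congr (_ * _).
  by rewrite mulrCA; congr (_ * _); rewrite mulKf.
Qed.

HB.instance Definition _ k x :=
  GRing.isDivringClosed.Build L (frac_adjoin k x) (@frac_adjoin_divring k x).

Lemma frac_adjoin_base k x : {subset k <= frac_adjoin k x}.
Proof.
move=> c hc; apply/frac_adjoinP; exists c%:P, 1.
by rewrite polyOverC hc rpred1 !hornerC oner_neq0 mulr1.
Qed.

Lemma frac_adjoin_var k x : x \in frac_adjoin k x.
Proof.
apply/frac_adjoinP; exists 'X, 1.
by rewrite polyOverX rpred1 !hornerE oner_neq0.
Qed.

End FractionField.

Section MonicDivision.
Variables (L : fieldType) (B : subringClosed L).

Lemma monic_division F p : F \in poly_ring B -> F \is monic -> p \in poly_ring B ->
  exists Q R, [/\ Q \in poly_ring B, R \in poly_ring B, (size R < size F)%N & p = F * Q + R].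
Proof.
move=> hF mF; have [n] := ubnP (size p); elim: n p => // n IH p; rewrite ltnS => sp hp.
have [lt|le] := ltnP (size p) (size F).
  by exists 0, p; rewrite rpred0 mulr0 add0r.
have sF : (0 < size F)%N by rewrite size_poly_gt0 monic_neq0.
have n0 : (0 < n)%N by apply: leq_trans sF (leq_trans le sp).
pose t := (p`_n.-1)%:P * 'X^(n - size F).
have ht : t \in poly_ring B.
  by rewrite rpredM ?polyOverXn // polyOverC; apply/polyOverP.
have [||Q [R [hQ hR sR e]]] := IH (p - F * t).
- rewrite -(prednK n0) ltnS; apply/leq_sizeP => j hj; rewrite coefB.
  rewrite /t mulrCA coefCM coefMXn; have le' := leq_trans le sp.
  case: ltnP => h; first by lia.
  move: hj; rewrite leq_eqVlt => /predU1P[<-|hj].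
    have -> : (n.-1 - (n - size F))%N = (size F).-1 by lia.
    by rewrite -[F`_ _]/(lead_coef F) (monicP mF) mulr1 subrr.
  have key (a b c : nat) : (b <= a)%N -> (a.-1 < c)%N -> (b <= c - (a - b))%N by lia.
  rewrite [p`_j]nth_default ?[F`_ _]nth_default ?mulr0 ?subr0 //; first exact: key.
  by apply: leq_trans sp _; rewrite -(prednK n0).
- by rewrite rpredB // rpredM.
exists (Q + t), R; split=> //; first exact: rpredD.
by rewrite mulrDr addrAC -e subrK.
Qed.

End MonicDivision.

(** * Laurent polynomial rings over a field *)

Section AdjoinDivision.
Variables (L : fieldType) (B : subringClosed L) (x : L) (laurent : bool).
Variables (F : {poly L}).
Hypotheses (tr : transcendental B x) (hF : F \in poly_ring B) (mF : F \is monic).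
Hypothesis (F0 : laurent -> F`_0 != 0 /\ (F`_0)^-1 \in B).
Local Notation A := (adjoin laurent B x).

Let d := (size F).-1.
(** A basis of the remainders modulo F(x). *)
Definition powers : 'rV[L]_d := \row_(j < d) x ^+ j.

Lemma powers_over : powers \is a mxOver (adjoin false B x).
Proof. by apply/mxOverP => i j; rewrite mxE rpredX // adjoin_var. Qed.

Let sF : size F = d.+1.
Proof. by rewrite prednK // size_poly_gt0 monic_neq0. Qed.

Let poly_of (c : 'cV[L]_d) : {poly L} := \poly_(j < d) (if insub j is Some i then c i 0 else 0).

Let poly_ofE c : powers *m c = ((poly_of c).[x])%:M.
Proof.
apply/matrixP => i j; rewrite !ord1 !mxE eqxx mulr1n horner_poly.
by apply: eq_bigr => l _; rewrite mxE valK mulrC.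
Qed.

Let horner_powers (R : {poly L}) : (size R <= d)%N ->
  (R.[x])%:M = powers *m \col_(j < d) R`_j.
Proof.
move=> sR; apply/matrixP => i j; rewrite !ord1 !mxE eqxx mulr1n (horner_coef_wide x sR).
by apply: eq_bigr => l _; rewrite !mxE mulrC.
Qed.

(** If F(0) is invertible, then x divides F(0) - F(x) in B[x], so that 1/x is
    congruent to a polynomial modulo F(x); this handles the negative powers of x. *)
Lemma adjoin_division_exists a : a \in A ->
  exists q (c : 'cV_d), [/\ q \in A, c \is a mxOver B & a%:M = (F.[x] * q)%:M + powers *m c].
Proof.
have hC p : p \in poly_ring B -> p.[x] \in A.
  by move=> hp; apply: adjoin_poly_sub; apply/adjoin_polyP; exists p.
suff H : forall a, a \in A -> exists q R, [/\ q \in A, R \in poly_ring B, (size R <= d)%N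
    & a = F.[x] * q + R.[x]].
  move=> /H[q [R [hq hR sR ->]]]; exists q, (\col_(j < d) R`_j); split=> //.
    by apply/mxOverP => i j; rewrite mxE; apply/polyOverP.
  by rewrite -horner_powers // -raddfD.
have divC p : p \in poly_ring B -> exists q R, [/\ q \in A, R \in poly_ring B, (size R <= d)%N
    & p.[x] = F.[x] * q + R.[x]].
  move=> hp; have [Q [R [hQ hR sR ->]]] := monic_division hF mF hp.
  exists Q.[x], R; split=> //; first exact: hC.
    by rewrite -ltnS -sF.
  by rewrite hornerD hornerM.
have x0 := transcendental_neq0 tr.
move=> {}a /adjoinP[j [p [hj hp ap]]].
have {ap} -> : a = x ^- j * p.[x] by rewrite -ap mulrC mulfK // expf_neq0.
move: hj; case: (posnP j) => [->|j0]; first by rewrite invr1 mul1r => _; apply: divC.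
rewrite orbF => la; have [F00 F0V] := F0 la.
have xVA : x^-1 \in A by rewrite la; apply: adjoin_inv.
have bA : {subset B <= A} by apply: adjoin_base.
elim: j {j0} => [|j [q [R [hq hR sR e]]]]; first by rewrite invr1 mul1r; apply: divC.
pose F1 := drop_poly 1 F.
have hF1 : F1 \in poly_ring B.
  by apply/polyOverP => i; rewrite coef_drop_poly; apply/polyOverP.
have FE : F.[x] = F`_0 + x * F1.[x].
  have {1}-> : F = (F`_0)%:P + F1 * 'X.
    apply/polyP => -[|i]; rewrite coefD coefC coefMX /= ?addr0 // add0r.
    by rewrite coef_drop_poly addn1.
  by rewrite hornerD hornerC hornerMX mulrC.
have [|q' [R' [hq' hR' sR' e']]] := divC (- ((F`_0)^-1 *: (F1 * R))).
  by rewrite rpredN polyOverZ // rpredM.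
exists (x^-1 * q + (F`_0)^-1 * x^-1 * R.[x] + q'), R'; split=> //.
  by rewrite !rpredD ?rpredM ?hC // bA.
have -> : x ^- j.+1 * p.[x] = x^-1 * (x ^- j * p.[x]) by rewrite exprS invfM mulrA.
have {e'} : R'.[x] = - ((F`_0)^-1 * (F1.[x] * R.[x])) - F.[x] * q'.
  by rewrite -hornerM -hornerZ -hornerN e' addrAC subrr add0r.
rewrite e FE => ->; field; exact/andP.
Qed.

(** After multiplication by x^j, the polynomial F divides X^j times the remainder.
    It is prime to X^j, and the remainder has smaller degree. *)
Lemma adjoin_division_unique q (c : 'cV_d) : q \in A -> c \is a mxOver B ->
  (F.[x] * q)%:M + powers *m c = 0 -> c = 0.
Proof.
move=> /adjoinP[j [Q [hj hQ qQ]]] hc; rewrite poly_ofE -raddfD => /matrixP/(_ 0 0).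
rewrite !mxE eqxx mulr1n => e.
have hR : poly_of c \in poly_ring B.
  apply: polyOver_poly => i lt; rewrite insubT /=.
  exact: (mxOverP hc).
have E : F * Q + 'X^j * poly_of c = 0.
  apply: tr; first by rewrite rpredD ?rpredM ?polyOverXn.
  rewrite hornerD !hornerM hornerXn -qQ mulrA (mulrC _ (x ^+ j)) -mulrDr.
  by rewrite e mulr0.
have dv : F %| 'X^j * poly_of c.
  by rewrite -(dvdp_addr _ (dvdp_mulr Q (dvdpp F))) E dvdp0.
have cop : coprimep F 'X^j.
  case/orP: hj => [la|/eqP->]; last exact: coprimep1.
  apply: coprimep_expr; rewrite coprimepX /root horner_coef0.
  by have [] := F0 la.
have {}dv : F %| poly_of c by rewrite -(Gauss_dvdpr _ cop).
have R0 : poly_of c = 0.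
  apply/eqP; apply/negPn/negP => R0; have := dvdp_leq R0 dv.
  by rewrite sF leqNgt ltnS size_poly.
apply/matrixP => i l; rewrite ord1 mxE.
have := congr1 (fun p : {poly L} => p`_i) R0; rewrite coef_poly coef0 ltn_ord.
by rewrite valK.
Qed.

End AdjoinDivision.

Lemma split_off_X (L : fieldType) (k : subringClosed L) (f : {poly L}) :
  f \in poly_ring k -> f != 0 ->
  exists j g, [/\ g \in poly_ring k, g`_0 != 0 & f = g * 'X^j].
Proof.
have [n] := ubnP (size f); elim: n f => // n IH f; rewrite ltnS => sf hf f0.
have [f00|f00] := eqVneq f`_0 0; last by exists 0%N, f; rewrite mulr1.
have fE : f = drop_poly 1 f * 'X.
  by apply/polyP => -[|i]; rewrite coefMX //= coef_drop_poly addn1.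
have [|||j [g [hg g0 e]]] := IH (drop_poly 1 f).
- rewrite size_drop_poly subn1; apply: leq_trans sf.
  by rewrite prednK // size_poly_gt0.
- by apply/polyOverP => i; rewrite coef_drop_poly; apply/polyOverP.
- by apply: contraNneq f0 => e; rewrite fE e mul0r.
by exists j.+1, g; rewrite fE e -mulrA -exprSr.
Qed.

Section LaurentRings.
Variable L : fieldType.
Implicit Types (k : divringClosed L) (x : L) (s : seq (bool * L)).

(** The head of the list is the variable adjoined last.  The flag says whether the
    inverse is adjoined too. *)
Fixpoint laurent_ring k s : subringClosed L :=
  if s is (l, x) :: s' then adjoin l (laurent_ring k s') x else k.

Fixpoint independent k s : Prop :=
  if s is (l, x) :: s' then transcendental (laurent_ring k s') x /\ independent k s'
  else True.

Lemma adjoin_mono l (B B' : subringClosed L) x :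
  {subset B <= B'} -> {subset adjoin l B x <= adjoin l B' x}.
Proof.
move=> sBB' a /adjoinP[j [p [hj hp e]]]; apply/adjoinP; exists j, p; split=> //.
exact: polyOverS hp.
Qed.

Lemma laurent_ring_mono k k' s :
  {subset k <= k'} -> {subset laurent_ring k s <= laurent_ring k' s}.
Proof. by move=> sk; elim: s => [|[l x] s IH] //=; apply: adjoin_mono. Qed.

Lemma laurent_ring_base k s : {subset k <= laurent_ring k s}.
Proof.
by elim: s => [|[l x] s IH] //= a /IH; apply: adjoin_base.
Qed.

Lemma common_denominator k x (B : subringClosed L) (I : finType) (a : I -> L) :
    (forall i, exists2 f, f \in poly_ring k /\ f.[x] != 0 & f.[x] * a i \in B) ->
    {subset adjoin false k x <= B} ->
  exists2 f, f \in poly_ring k /\ f.[x] != 0 & forall i, f.[x] * a i \in B.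
Proof.
move=> h sub.
have /choice[f hf] i : exists f, [/\ f \in poly_ring k, f.[x] != 0 & f.[x] * a i \in B].
  by have [f [? ?] ?] := h i; exists f.
exists (\prod_i f i).
  split; first by apply: rpred_prod => i _; case: (hf i).
  by rewrite horner_prod; apply/prodf_neq0 => i _; case: (hf i).
move=> i; rewrite (bigD1 i) //= hornerM mulrAC rpredM //; first by case: (hf i).
apply: sub; apply/adjoin_polyP; eexists; last by [].
by apply: rpred_prod => l _; case: (hf l).
Qed.

(** Clear the denominators of the finitely many coefficients, one variable after the
    other. *)
Lemma laurent_ring_denominator k x s a : independent k s ->
  a \in laurent_ring (frac_adjoin k x) s ->
  exists2 f, f \in poly_ring k /\ f.[x] != 0 & f.[x] * a \in adjoin false (laurent_ring k s) x.
Proof.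
elim: s a => [|[l z] s IH] a /=.
  move=> _ /frac_adjoinP[p [q [hp hq q0 e]]]; exists q => //.
  by rewrite mulrC e; apply/adjoin_polyP; exists p.
move=> [trz ind] /adjoinP[j [P [hj /polyOverP hP e]]].
have z0 := transcendental_neq0 trz.
have [||f [hf f0] hfP] := @common_denominator k x
    (adjoin false (laurent_ring k s) x) 'I_(size P) (fun i => P`_i).
- by move=> i; apply: IH.
- exact/adjoin_mono/laurent_ring_base.
exists f => //.
have -> : f.[x] * a = \sum_(i < size P) (f.[x] * P`_i) * (z ^+ i / z ^+ j).
  transitivity (f.[x] * (P.[z] / z ^+ j)); first by rewrite -e mulfK // expf_neq0.
  rewrite (horner_coef P z) mulr_suml mulr_sumr; apply: eq_bigr => i _.
  by rewrite !mulrA.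
apply: rpred_sum => i _; apply: rpredM.
  by apply: adjoin_mono (hfP i); apply: adjoin_base.
apply: adjoin_base; apply: rpredM; first by rewrite rpredX // adjoin_var.
case/orP: hj => [-> |/eqP->]; last by rewrite invr1 rpred1.
by rewrite -exprVn rpredX // adjoin_inv.
Qed.

(** Let p(z) = 0 with coefficients involving k(x), and clear denominators.  The
    result is a polynomial in x whose coefficients are polynomials in z over a ring
    without x; they vanish as x is transcendental, and then their own coefficients
    vanish as z is. *)
Lemma independent_frac k x s : independent k s -> transcendental (laurent_ring k s) x ->
  independent (frac_adjoin k x) s.
Proof.
elim: s => [|[l z] s IH] //= [trz ind] trx; split; last first.
  by apply: IH => // p hp; apply: trx; apply: polyOverS hp; apply: adjoin_base.
move=> p /polyOverP hp pz.
have [||f [hf f0] hfp] := @common_denominator k x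
    (adjoin false (laurent_ring k s) x) 'I_(size p) (fun i => p`_i).
- by move=> i; apply: laurent_ring_denominator.
- exact/adjoin_mono/laurent_ring_base.
have /choice[P hP] (i : 'I_(size p)) : exists P, P \in poly_ring (laurent_ring k s) /\ f.[x] * p`_i = P.[x].
  by have /adjoin_polyP[P] := hfp i; exists P.
have Q0 : \sum_(i < size p) z ^+ i *: P i = 0.
  apply: trx.
    apply: rpred_sum => i _; apply: polyOverZ; first by rewrite rpredX // adjoin_var.
    by have [h _] := hP i; apply: polyOverS h; apply: adjoin_base.
  rewrite horner_sum; transitivity (f.[x] * p.[z]); last by rewrite pz mulr0.
  rewrite (horner_coef p z) mulr_sumr; apply: eq_bigr => i _.
  by rewrite hornerZ; have [_ <-] := hP i; rewrite mulrCA (mulrC (z ^+ i)).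
have P0 i : P i = 0.
  apply/polyP => j; rewrite coef0.
  pose R := \sum_(i < size p) (P i)`_j *: 'X^i : {poly L}.
  have hR : R = 0.
    apply: trz.
      apply: rpred_sum => l' _; apply: polyOverZ; last exact: polyOverXn.
      by have [/polyOverP h _] := hP l'.
    rewrite horner_sum; have := congr1 (fun q : {poly L} => q`_j) Q0.
    rewrite coef_sum coef0 => e; rewrite -[RHS]e; apply: eq_bigr => i' _.
    by rewrite hornerZ hornerXn coefZ mulrC.
  have := congr1 (fun q : {poly L} => q`_i) hR; rewrite coef0 coef_sum => e; rewrite -[RHS]e.
  rewrite (bigD1 i) //= coefZ coefXn eqxx mulr1 big1 ?addr0 // => i' ne.
  by rewrite coefZ coefXn eq_sym (inj_eq val_inj) (negPf ne) mulr0.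
apply/polyP => i; rewrite coef0; have [lt|le] := ltnP i (size p); last by rewrite nth_default.
have [_] := hP (Ordinal lt); rewrite P0 horner0 => /eqP; rewrite mulf_eq0 (negPf f0).
by move=> /eqP.
Qed.

(** Induction on the number of variables, for all fields k at once, because the
    step uses the ring without x both over k and over k(x). *)
Theorem laurent_ring_free k s : independent k s -> projective_free (laurent_ring k s).
Proof.
elim: s k => [|[l x] s IH] k /=; first by move=> _; apply: subfield_free.
move=> [trx ind] n E hE EE.
set B := laurent_ring k s in trx *; pose K := frac_adjoin k x.
have x0 := transcendental_neq0 trx.
have freeB : projective_free B by apply: IH.
have kB : {subset k <= B} by apply: laurent_ring_base.
have KA : {subset K <= laurent_ring K s} by apply: laurent_ring_base.
have AA' : {subset adjoin l B x <= laurent_ring K s}.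
  move=> a /adjoinP[j [p [_ hp e]]].
  have -> : a = p.[x] / x ^+ j by rewrite -e mulfK // expf_neq0.
  have xK : x \in K by apply: frac_adjoin_var.
  rewrite rpredM //; last by apply: KA; rewrite rpredVr ?rpredX.
  rewrite rpred_horner ?KA //; apply: polyOverS hp.
  exact/laurent_ring_mono/frac_adjoin_base.
have [|r [U [V [hU hV UV VU]]]] := IH K _ n E (mxOverS AA' hE) EE.
  exact: independent_frac.
have common : exists2 f, f \in poly_ring k /\ f.[x] != 0 &
    f.[x] *: U \is a mxOver (adjoin false B x) /\ f.[x] *: V \is a mxOver (adjoin false B x).
  have [||f hf hfUV] := @common_denominator k x (adjoin false B x)
     ('I_n * 'I_r + 'I_r * 'I_n)%type
     (fun i => match i with inl i => U i.1 i.2 | inr i => V i.1 i.2 end).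
  - move=> i; apply: laurent_ring_denominator => //.
    by case: i => i; [apply: (mxOverP hU)|apply: (mxOverP hV)].
  - exact: adjoin_mono.
  by exists f => //; split; apply/mxOverP => i j; rewrite mxE;
    [apply: (hfUV (inl (i, j)))|apply: (hfUV (inr (i, j)))].
(* normalize f, dividing by a power of x in the Laurent case *)
have [f [hf mf f0 [hfU hfV]]] : exists f, [/\ f \in poly_ring k, f \is monic, l -> f`_0 != 0 &
    f.[x] *: U \is a mxOver (adjoin l B x) /\ f.[x] *: V \is a mxOver (adjoin l B x)].
  case: common => f [hf fx0] [hfU hfV].
  have f0 : f != 0 by apply: contraNneq fx0 => ->; rewrite horner0.
  have [j [g [hj hg g0 g00 fE]]] : exists j g, [/\ l || (j == 0%N), g \in poly_ring k, g != 0,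
      l -> g`_0 != 0 & f = g * 'X^j].
    case: (l); last by exists 0%N, f; rewrite mulr1.
    have [j [g [hg g00 fE]]] := split_off_X hf f0; exists j, g; split=> //.
    by apply: contraNneq f0 => g0; rewrite fE g0 mul0r.
  pose c := (lead_coef g)^-1; have c0 : c != 0 by rewrite invr_eq0 lead_coef_eq0.
  have ck : c \in k by rewrite rpredVr //; apply/polyOverP.
  exists (c *: g); split; first exact: polyOverZ.
  - by rewrite monicE lead_coefZ mulVf // lead_coef_eq0.
  - by move=> /g00 ?; rewrite coefZ mulf_neq0.
  have -> : (c *: g).[x] = c * x ^- j * f.[x].
    rewrite fE hornerM hornerXn hornerZ -[RHS]mulrA; congr (_ * _).
    by rewrite mulrCA mulVf ?expf_neq0 // mulr1.
  have cA : c * x ^- j \in adjoin l B x.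
    rewrite rpredM //; first exact/adjoin_base/kB.
    case/orP: hj => [-> |/eqP->]; last by rewrite invr1 rpred1.
    by rewrite -exprVn rpredX // adjoin_inv.
  by split; rewrite -scalerA mxOverZ //; exact: (mxOverS (@adjoin_poly_sub _ l B x)).
have f0x : f.[x] != 0.
  apply/eqP => fx0; have /eqP := trx f (polyOverS kB hf) fx0.
  by rewrite (negPf (monic_neq0 mf)).
have mf2 : f * f \is monic by rewrite monicMl.
have hf2 : f * f \in poly_ring B by rewrite rpredM //; apply: polyOverS hf.
have f20 : l -> (f * f)`_0 != 0 /\ ((f * f)`_0)^-1 \in B.
  move=> /f0 f00; rewrite coef0M mulf_neq0 //; split=> //; apply: kB.
  by rewrite rpredVr // rpredM //; apply/polyOverP.
apply: (split_idempotent_adjoin trx freeB (@adjoin_poly_sub _ l B x) (D := (f * f).[x]) _ _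
  (powers_over _ _ _) (adjoin_division_exists trx hf2 mf2 f20)
  (adjoin_division_unique trx hf2 mf2 f20) hE hfV hfU).
- by rewrite hornerM mulf_neq0.
- move=> m w hw; case: (l) hw => hw; last by exists 0%N; rewrite invr1 rpred1 scale1r.
  have [i j j' le /adjoin_polyP[p hp e]|i|J hJ] := @uniform_bound 'I_m
      (fun i j => x ^+ j * w i 0 \in adjoin false B x).
  - by rewrite -(subnK le) exprD -mulrA rpredM ?rpredX ?adjoin_var //; apply/adjoin_polyP; exists p.
  - have /adjoinP[j [p [_ hp e]]] := mxOverP hw i 0.
    by exists j; apply/adjoin_polyP; exists p; rewrite // mulrC.
  exists J; rewrite -exprVn rpredX ?adjoin_inv //; split=> //.
  by apply/mxOverP => i i'; rewrite mxE ord1.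
- by rewrite -scalemxAl -scalemxAr scalerA VU hornerM scalemx1.
- by rewrite -scalemxAl -scalemxAr scalerA UV hornerM.
Qed.

End LaurentRings.

(** * The perfected Laurent ring as a union of Laurent rings *)

Section Monomials.
Variables (A : comNzRingType) (M : nmodType).
Implicit Types (g h : monoid_algebra A M) (e f : M).

Lemma mtermM (c d : A) e f : mterm c e * mterm d f = mterm (c * d) (e + f).
Proof. exact: mmul_term. Qed.

Lemma mterm_one : mterm 1 0 = 1 :> monoid_algebra A M.
Proof. by []. Qed.

Lemma mcoeff_mul e g h : mcoeff e (g * h) =
  \sum_(e1 <- msupp g) \sum_(e2 <- msupp h) (mcoeff e1 g * mcoeff e2 h) *+ (e1 + e2 == e).
Proof.
rewrite (raddf_sum (mcoeff e)); apply: eq_bigr => e1 _.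
rewrite (raddf_sum (mcoeff e)); apply: eq_bigr => e2 _.
exact: mcoeff_term.
Qed.

Lemma mcoeff_mul_term e g (c : A) f :
  mcoeff e (g * mterm c f) = \sum_(e1 <- msupp g) (mcoeff e1 g * c) *+ (e1 + f == e).
Proof.
rewrite [X in X * _](mtermE g) mulr_suml (raddf_sum (mcoeff e)); apply: eq_bigr => e1 _.
by rewrite mtermM /= mcoeff_term.
Qed.

End Monomials.

Lemma seq_maximizer (T : eqType) (f : T -> rat) (s : seq T) : s != [::] ->
  exists2 a, a \in s & forall b, b \in s -> f b <= f a.
Proof.
elim: s => // a s IH _; have [->|/IH[b bs hb]] := eqVneq s [::].
  by exists a; rewrite ?mem_head // => b; rewrite inE => /eqP->.
have [le|lt] := lerP (f a) (f b).
  by exists b; rewrite ?inE ?bs ?orbT // => c; rewrite inE => /predU1P[->|/hb].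
exists a; rewrite ?mem_head // => c; rewrite inE => /predU1P[->//|/hb h].
exact: le_trans h (ltW lt).
Qed.

Section Exponent.
Variables p r n : nat.
Local Notation expo := (exponent p r n).
Implicit Types e f : expo.

Lemma expoD e f i : expval (e + f) i = expval e i + expval f i.
Proof. by rewrite [expval _](_ : _ = expval e + expval f) // ffunE. Qed.

Lemma expo0 i : expval (0 : expo) i = 0.
Proof. by rewrite [expval _](_ : _ = 0) // ffunE. Qed.

Lemma expoMn e m i : expval (e *+ m) i = expval e i *+ m.
Proof. by elim: m => [|m IH]; rewrite ?mulr0n ?expo0 // !mulrS expoD IH. Qed.

Lemma expo_inj e f : (forall i, expval e i = expval f i) -> e = f.
Proof. by move=> h; apply/val_inj/ffunP. Qed.

Lemma expo_addIr e f f' : e + f = e + f' -> f = f'.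
Proof.
move=> E; apply: expo_inj => i; have := congr1 (fun e' => expval e' i) E.
by rewrite !expoD => /addrI.
Qed.

(** This is the sum of the lexicographic maxima.  The induction treats one coordinate
    at a time, keeping only the exponents that maximize it. *)
Lemma unique_sum (s t : seq expo) : s != [::] -> t != [::] ->
  exists e f, [/\ e \in s, f \in t & forall e' f', e' \in s -> f' \in t ->
    e' + f' = e + f -> e' = e /\ f' = f].
Proof.
suff H : forall cs : seq 'I_n, forall s t : seq expo, s != [::] -> t != [::] ->
  exists e f, [/\ e \in s, f \in t & forall e' f', e' \in s -> f' \in t ->
    e' + f' = e + f -> forall i, i \in cs -> expval e' i = expval e i /\ expval f' i = expval f i].
  move=> s0 t0; have [e [f [he hf h]]] := H (enum 'I_n) s t s0 t0.
  exists e, f; split=> // e' f' he' hf' E.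
  by split; apply: expo_inj => i; case: (h e' f' he' hf' E i (mem_enum _ _)).
elim=> [|i cs IH] {s t} s t s0 t0.
  case: s s0 => // e s _; case: t t0 => // f t _.
  by exists e, f; rewrite !mem_head.
have [a sa ha] := seq_maximizer (fun e => expval e i) s0.
have [b tb hb] := seq_maximizer (fun e => expval e i) t0.
have [||e [f []]] := IH [seq e <- s | expval e i == expval a i] [seq f <- t | expval f i == expval b i].
- by apply/eqP => E; have : a \in [::] by rewrite -E mem_filter eqxx.
- by apply/eqP => E; have : b \in [::] by rewrite -E mem_filter eqxx.
rewrite !mem_filter => /andP[/eqP ea es] /andP[/eqP fb ft] h.
exists e, f; split=> // e' f' es' ft' E.
have Ei : expval e' i + expval f' i = expval a i + expval b i.
  by rewrite -ea -fb -!expoD E.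
have le1 := ha _ es'; have le2 := hb _ ft'.
have e'a : expval e' i = expval a i by lra.
have f'b : expval f' i = expval b i by lra.
move=> j; rewrite inE => /predU1P[->|hj]; first by rewrite e'a f'b ea fb.
by apply: (h e' f') => //; rewrite mem_filter ?e'a ?f'b eqxx.
Qed.

Lemma mcoeff_unique_sum (A : comNzRingType) (g h : monoid_algebra A expo) e f :
    e \in msupp g -> f \in msupp h ->
    (forall e' f', e' \in msupp g -> f' \in msupp h -> e' + f' = e + f -> e' = e /\ f' = f) ->
  mcoeff (e + f) (g * h) = mcoeff e g * mcoeff f h.
Proof.
move=> he hf H; rewrite mcoeff_mul (big_fsetD1 e) //= (big_fsetD1 f) //= eqxx mulr1n.
rewrite big1_seq ?addr0; last first.
  move=> f' /andP[_]; rewrite !inE => /andP[ne hf']; case: eqP => // E.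
  by have [_ ff] := H _ _ he hf' E; rewrite ff eqxx in ne.
rewrite big1_seq ?addr0 // => e' /andP[_]; rewrite !inE => /andP[ne he'].
rewrite big1_seq // => f' /andP[_ hf']; case: eqP => // E.
by have [ee _] := H _ _ he' hf' E; rewrite ee eqxx in ne.
Qed.

End Exponent.

Section Domain.
Variables (k : fieldType) (p r n : nat).
Local Notation S := (perf_laurent k p r n).

Lemma msupp_neq0 (g : S) : g != 0 -> (msupp g : seq _) != [::].
Proof.
apply: contraNneq => E; apply/eqP/malgP => e; rewrite mcoeff0.
by apply: mcoeff_outdom; rewrite -[_ \in _]/(e \in (msupp g : seq _)) E.
Qed.

Lemma perf_laurent_idomain (x y : S) : x * y = 0 -> (x == 0) || (y == 0).
Proof.
move=> xy; apply/norP => -[x0 y0].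
have [e [f [he hf H]]] := unique_sum (msupp_neq0 x0) (msupp_neq0 y0).
have := mcoeff_unique_sum he hf H; rewrite [x * y]xy mcoeff0 => /esym/eqP.
by rewrite mulf_eq0 => /orP[] /eqP; apply/eqP; rewrite mcoeff_neq0.
Qed.

Definition perf_unit : {pred S} := [pred x | `[< exists y, y * x = 1 >]].

(** The inverse is chosen; outside of the units it is the identity, as the interface
    of rings with units requires. *)
Definition perf_inv (x : S) : S :=
  if pselect (exists y, y * x = 1) is left h then sval (cid h) else x.

Lemma perf_mulVx : {in perf_unit, left_inverse 1 perf_inv *%R}.
Proof.
move=> x /asboolP h; rewrite /perf_inv; case: pselect => // h'.
exact: (svalP (cid h')).
Qed.

Lemma perf_unitP (x y : S) : y * x = 1 -> x \in perf_unit.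
Proof. by move=> h; apply/asboolP; exists y. Qed.

Lemma perf_inv_out : {in [predC perf_unit], perf_inv =1 id}.
Proof.
move=> x /negP h; rewrite /perf_inv; case: pselect => // h'.
by case: h; apply/asboolP.
Qed.

HB.instance Definition _ := GRing.ComNzRing_hasMulInverse.Build S
  perf_mulVx perf_unitP perf_inv_out.
HB.instance Definition _ := GRing.ComUnitRing_isIntegral.Build S perf_laurent_idomain.

End Domain.

Section Freeness.
Variables (k : fieldType) (p r n : nat).
Hypothesis p_pr : prime p.
Local Notation expo := (exponent p r n).
Local Notation S := (perf_laurent k p r n).
Local Notation L := {fraction S}.
Local Notation "x %:F" := (@FracField.tofrac S x).

Definition monomial (e : expo) : L := (mterm 1 e : S)%:F.

Lemma monomialD e f : monomial (e + f) = monomial e * monomial f.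
Proof. by rewrite /monomial -tofracM [_ * _ : S]mtermM mul1r. Qed.

Lemma monomial0 : monomial 0 = 1.
Proof. exact: tofrac1. Qed.

Lemma monomialMn e m : monomial (e *+ m) = monomial e ^+ m.
Proof. by elim: m => [|m IH]; rewrite ?monomial0 // mulrS exprS monomialD IH. Qed.

Lemma monomial_sum (I : Type) (s : seq I) (F : I -> expo) :
  monomial (\sum_(i <- s) F i) = \prod_(i <- s) monomial (F i).
Proof. exact: (big_morph monomial monomialD monomial0). Qed.

Definition scalars : {pred L} := [pred y | `[< exists c : k, y = (mterm c 0 : S)%:F >]].

Lemma scalarsP y : reflect (exists c : k, y = (mterm c 0 : S)%:F) (y \in scalars).
Proof. exact: asboolP. Qed.

Lemma mtermM0 (c d : k) : (mterm c 0 : S)%:F * (mterm d 0 : S)%:F = (mterm (c * d) 0 : S)%:F.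
Proof. by rewrite -tofracM [_ * _ : S]mtermM addr0. Qed.

Lemma scalars_divring : divring_closed scalars.
Proof.
split=> [|x y /scalarsP[c ->] /scalarsP[d ->]|x y /scalarsP[c ->] /scalarsP[d ->]]; apply/scalarsP.
- by exists 1; rewrite -monomial0.
- by exists (c - d); rewrite -tofracB; congr (_%:F); rewrite -[LHS](raddfB (@mkmalgU _ _ 0)).
- exists (c / d); have [->|d0] := eqVneq d 0.
    by rewrite invr0 mulr0 mterm0 !tofrac0 invr0 mulr0.
  have dn0 : (mterm d 0 : S)%:F != 0.
    rewrite tofrac_eq0; apply: contra_neq d0 => /(congr1 (mcoeff 0)).
    by rewrite mcoeff_term eqxx mcoeff0.
  by apply: (mulIf dn0); rewrite mulfVK // mtermM0 divfK.
Qed.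

HB.instance Definition _ := GRing.isDivringClosed.Build L scalars scalars_divring.

Definition axis_fun (i : 'I_n) (q : rat) : {ffun 'I_n -> rat} :=
  [ffun j => if j == i then q else 0].

Lemma axis_valid (i : 'I_n) q : p.-nat `|denq q|%N -> ((i < r)%N ==> (0 <= q)) ->
  axis_fun i q \in @perf_exponent p r n.
Proof.
move=> hq hi; apply/forallP => j; rewrite ffunE; case: eqP => [->|_]; first by rewrite hq.
by rewrite lexx implybT.
Qed.

(** The exponent of X_i^q, or 0 if that is not allowed. *)
Definition axis (i : 'I_n) q : expo :=
  if (boolP (axis_fun i q \in @perf_exponent p r n)) is AltTrue h then Exponent h else 0.

Lemma axisE (i : 'I_n) q j : p.-nat `|denq q|%N -> ((i < r)%N ==> (0 <= q)) ->
  expval (axis i q) j = if j == i then q else 0.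
Proof.
move=> hq hi; rewrite /axis; case: {-}_ / boolP => [h|/negP[]]; last exact: axis_valid.
by rewrite ffunE.
Qed.

Lemma pnat_denq_frac (z : int) m : p.-nat `|denq (z%:~R / (p ^ m)%:R)|%N.
Proof.
have : p.-nat `|(p ^ m)%:Z|%N by rewrite absz_nat pnatX pnat_id.
rewrite -[(p ^ m)%:R]/((p ^ m)%:Z%:~R).
case: divqP => [/eqP|l z' l0]; first by rewrite eqz_nat expn_eq0 -leqn0 leqNgt prime_gt0.
by rewrite abszM pnatM => /andP[].
Qed.

(** X^e is a monomial in the p^m-th roots of the variables. *)
Definition level m (e : expo) : Prop := forall i, expval e i * (p ^ m)%:R \is a Num.int.

Lemma level_mono m m' e : (m <= m')%N -> level m e -> level m' e.
Proof.
move=> /subnKC <- h i; rewrite expnD natrM mulrA rpredM //.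
exact: rpred_nat.
Qed.

(** The denominators are powers of p. *)
Lemma level_exists e : exists m, level m e.
Proof.
apply: uniform_bound => [i m m' /subnKC <- h|i].
  by rewrite expnD natrM mulrA rpredM // rpred_nat.
have /andP[/p_natP[m hm] _] := forallP (expvalP e) i.
exists m; have <- : (denq (expval e i))%:~R = (p ^ m)%:R :> rat.
  by rewrite -hm -{1}(gez0_abs (denq_ge0 _)).
by rewrite -numqE rpred_int.
Qed.

Section Level.
Variable m : nat.
Let q : rat := ((p ^ m)%:R)^-1.

Let q0 : 0 < q. Proof. by rewrite invr_gt0 ltr0n expn_gt0 prime_gt0. Qed.

Let qZ (z : int) : p.-nat `|denq (z%:~R * q)|%N.
Proof. exact: pnat_denq_frac. Qed.

(** The p^m-th root of X_i. *)
Definition var (i : 'I_n) : L := monomial (axis i q).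

Lemma axis_qE (i : 'I_n) j : expval (axis i q) j = if j == i then q else 0.
Proof. by rewrite axisE ?ltW ?implybT //; have := qZ 1; rewrite mul1r. Qed.

Definition vars (l : seq 'I_n) : seq (bool * L) :=
  [seq (~~ (i < r)%N, var i) | i : 'I_n <- l].

Lemma var_neq0 (i : 'I_n) : var i != 0.
Proof.
rewrite tofrac_eq0; apply/eqP => /(congr1 (mcoeff (axis i q))) /eqP.
by rewrite mcoeff_term eqxx mcoeff0 oner_eq0.
Qed.

Lemma var_inv (i : 'I_n) : (r <= i)%N -> (var i)^-1 = monomial (axis i (- q)).
Proof.
move=> ri; apply: (mulfI (var_neq0 i)); rewrite mulfV ?var_neq0 // -monomialD -monomial0.
congr monomial; apply: expo_inj => j; rewrite expo0 expoD axis_qE axisE.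
- by case: eqP; rewrite ?addr0 ?subrr.
- by have := qZ (-1); rewrite mulN1r.
- by rewrite ltnNge ri.
Qed.

Local Notation ring l := (laurent_ring scalars (vars l)).

Lemma var_in (l : seq 'I_n) (i : 'I_n) : i \in l ->
  (var i \in ring l) /\ ((r <= i)%N -> (var i)^-1 \in ring l).
Proof.
elim: l => //= j l IH; rewrite inE => /predU1P[->|/IH[h1 h2]].
  by split=> [|rj]; [apply: adjoin_var|rewrite -leqNgt rj; apply: adjoin_inv; apply: var_neq0].
by split=> [|ri]; apply: adjoin_base => //; apply: h2.
Qed.

Lemma monomial_in e : level m e -> monomial e \in ring (enum 'I_n).
Proof.
move=> he.
have -> : e = \sum_i axis i (expval e i).
  apply: expo_inj => j; rewrite (big_morph (fun e => expval e j) (fun e f => expoD e f j) (@expo0 p r n j)).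
  rewrite (bigD1 j) //= big1 ?addr0 => [|i ne].
    by have /andP[h1 h2] := forallP (expvalP e) j; rewrite axisE ?eqxx.
  have /andP[h1 h2] := forallP (expvalP e) i.
  by rewrite axisE // eq_sym (negPf ne).
rewrite monomial_sum; apply: rpred_prod => i _.
have /andP[h1 h2] := forallP (expvalP e) i.
have [hv hVv] := var_in (mem_enum 'I_n i).
have /intrP[z hz] := he i.
have pm0 : (p ^ m)%:R != 0 :> rat by rewrite pnatr_eq0 expn_eq0 -leqn0 leqNgt prime_gt0.
have {hz} ez : expval e i = z%:~R * q by rewrite -hz mulfK.
case: z ez => z ez.
  suff -> : monomial (axis i (expval e i)) = var i ^+ z by rewrite rpredX.
  rewrite -monomialMn; congr monomial; apply: expo_inj => j; rewrite expoMn axis_qE axisE //.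
  by case: eqP => _; rewrite ?mul0rn // ez mulr_natl.
have ri : (r <= i)%N.
  rewrite leqNgt; apply/negP => /(implyP h2); rewrite ez NegzE rmorphN mulNr oppr_ge0.
  by rewrite leNgt mulr_gt0.
suff -> : monomial (axis i (expval e i)) = (var i)^-1 ^+ z.+1 by rewrite rpredX // hVv.
rewrite var_inv // -monomialMn; congr monomial; apply: expo_inj => j; rewrite expoMn !axisE //.
- by case: eqP => _; rewrite ?mul0rn // ez NegzE rmorphN mulNrn mulNr mulr_natl.
- by have := qZ (-1); rewrite mulN1r.
- by rewrite ltnNge ri.
Qed.

Lemma scalar_in l (c : k) : (mterm c 0 : S)%:F \in ring l.
Proof. by apply: laurent_ring_base; apply/scalarsP; exists c. Qed.

Lemma level_in (g : S) : (forall e, e \in msupp g -> level m e) -> g%:F \in ring (enum 'I_n).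
Proof.
move=> h; rewrite (mtermE g : g = _ :> S) (big_morph _ (@tofracD S) (@tofrac0 S)).
rewrite big_seq; apply: rpred_sum => e he.
have -> : (mterm (mcoeff e g) e : S)%:F = (mterm (mcoeff e g) 0 : S)%:F * monomial e.
  by rewrite -tofracM [_ * _ : S]mtermM mulr1 add0r.
by apply: rpredM; [apply: scalar_in|apply/monomial_in/h].
Qed.

(** Elements of the perfected ring that involve no variable outside of l. *)
Definition involving (l : seq 'I_n) : {pred L} := [pred y | `[< exists2 g : S, y = g%:F &
  forall e i, i \notin l -> expval e i != 0 -> mcoeff e g = 0 >]].

Lemma involvingP l y : reflect (exists2 g : S, y = g%:F &
  forall e i, i \notin l -> expval e i != 0 -> mcoeff e g = 0) (y \in involving l).
Proof. exact: asboolP. Qed.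

Lemma involving_subring l : subring_closed (involving l).
Proof.
split=> [|x y /involvingP[g -> hg] /involvingP[h -> hh]|x y /involvingP[g -> hg] /involvingP[h -> hh]];
  apply/involvingP.
- exists 1 => [|e i _ ei]; first by rewrite tofrac1.
  by rewrite -mterm_one mcoeff_term; case: eqP => // e0; rewrite -e0 expo0 eqxx in ei.
- exists (g - h) => [|e i il ei]; first by rewrite tofracB.
  by rewrite (mcoeffB e) (hg e i) // (hh e i) // subrr.
- exists (g * h) => [|e i il ei]; first by rewrite tofracM.
  rewrite mcoeff_mul big1 // => e1 _; rewrite big1 // => e2 _; case: eqP => // E.
  have [z1|n1] := eqVneq (expval e1 i) 0; last by rewrite (hg e1 i) ?mul0r.
  by rewrite (hh e2 i) ?mulr0 //; move: ei; rewrite -E expoD z1 add0r.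
Qed.

HB.instance Definition _ l := GRing.isSubringClosed.Build L (involving l) (involving_subring l).

Lemma monomial_involving l (i : 'I_n) a : i \in l -> (forall j, j != i -> expval a j = 0) ->
  monomial a \in involving l.
Proof.
move=> il ha; apply/involvingP; exists (mterm 1 a : S) => // e j jl ej.
rewrite mcoeff_term; case: eqP => // E; rewrite -E ha ?eqxx // in ej.
by apply: contraNneq jl => ->.
Qed.

(** This also shows that the Laurent rings consist of elements of the perfected
    ring. *)
Lemma ring_involving l : {subset ring l <= involving l}.
Proof.
elim: l => [|i l IH] /= a.
  move=> /scalarsP[c ->]; apply/involvingP; exists (mterm c 0 : S) => // e i _ ei.
  by rewrite mcoeff_term; case: eqP => // e0; rewrite -e0 expo0 eqxx in ei.
move=> /adjoinP[j [P [hj hP E]]].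
have sub : {subset involving l <= involving (i :: l)}.
  move=> y /involvingP[g -> hg]; apply/involvingP; exists g => // e i' hi'.
  by apply: hg; apply: contra hi'; rewrite inE orbC => ->.
have vi : var i \in involving (i :: l).
  apply: (@monomial_involving _ i); rewrite ?mem_head // => j' ne.
  by rewrite axis_qE (negPf ne).
have -> : a = P.[var i] * (var i)^-1 ^+ j by rewrite -E exprVn mulfK // expf_neq0 ?var_neq0.
apply: rpredM.
  by apply: rpred_horner => //; apply: polyOverS hP => b /IH/sub.
case/orP: hj => [ri|/eqP->]; last exact: rpred1.
have {}ri : (r <= i)%N by rewrite leqNgt.
have vN : monomial (axis i (- q)) \in involving (i :: l).
  apply: (@monomial_involving _ i); rewrite ?mem_head // => j' ne.
  rewrite axisE ?(negPf ne) //; last by rewrite ltnNge ri.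
  by have := qZ (-1); rewrite mulN1r.
rewrite -(var_inv ri) in vN.
exact: rpredX.
Qed.

Lemma mcoeff_shift (g : S) (c : k) e f : mcoeff (e + f) (g * mterm c f : S) = mcoeff e g * c.
Proof.
rewrite [LHS]mcoeff_mul_term; have eE e1 : (e1 + f == e + f) = (e1 == e).
  by apply/eqP/eqP => [|->//]; rewrite !(addrC _ f) => /expo_addIr.
have [he|he] := boolP (e \in msupp g); last first.
  rewrite (mcoeff_outdom he) mul0r big1_seq // => e1 /andP[_ h1]; rewrite eE.
  by case: eqP => // E; case/negP: he; rewrite -E.
rewrite (big_fsetD1 e) //= eqxx mulr1n big1_seq ?addr0 // => e1 /andP[_].
by rewrite !inE eE => /andP[/negPf->].
Qed.

(** In a polynomial in [var i] over the elements not involving X_i, the terms of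
    different degrees have different exponents of X_i, so they cannot cancel. *)
Lemma var_transcendental l (i : 'I_n) : i \notin l -> transcendental (ring l) (var i).
Proof.
move=> il P /polyOverP hP Py.
have /choice[g hg] (j : nat) : exists g : S, P`_j = g%:F /\
    forall e i, i \notin l -> expval e i != 0 -> mcoeff e g = 0.
  by have /involvingP[g] := ring_involving (hP j); exists g.
have E : \sum_(j < size P) g j * (mterm 1 (axis i q *+ j) : S) = 0.
  apply/eqP; rewrite -tofrac_eq0 (big_morph _ (@tofracD S) (@tofrac0 S)) -[X in _ == X]Py.
  rewrite horner_coef; apply/eqP/eq_bigr => j _; rewrite tofracM.
  by have [<- _] := hg j; rewrite /var -monomialMn.
apply/polyP => j; rewrite coef0.
have [lt|le] := ltnP j (size P); last by rewrite nth_default.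
have [-> gj] := hg j; rewrite (_ : g j = 0) ?tofrac0 //.
apply/malgP => e; rewrite mcoeff0.
have [ei|ei] := eqVneq (expval e i) 0; last exact: gj il ei.
have := congr1 (mcoeff (e + axis i q *+ j)) E.
rewrite (raddf_sum (mcoeff _)) mcoeff0 (bigD1 (Ordinal lt)) //= big1 => [|j' ne].
  by rewrite addr0 mcoeff_shift mulr1.
rewrite [LHS]mcoeff_mul_term big1 // => e1 _; case: eqP => // /(congr1 (fun f => expval f i)).
rewrite !expoD !expoMn axis_qE eqxx ei add0r => Eq.
have [z1|n1] := eqVneq (expval e1 i) 0; last first.
  by have [_ h] := hg j'; rewrite (h _ i) ?mul0r.
move: Eq; rewrite z1 add0r -(mulr_natr q j') -(mulr_natr q j) => /(mulfI (lt0r_neq0 q0))/eqP.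
by rewrite eqr_nat => /eqP jj; case/eqP: ne; apply/val_inj.
Qed.

Lemma vars_independent l : uniq l -> independent scalars (vars l).
Proof.
elim: l => //= i l IH /andP[il ul]; split; last exact: IH.
exact: var_transcendental.
Qed.

End Level.

(** An idempotent matrix has entries in the Laurent ring of some level m, and this
    Laurent ring is contained in the perfected ring. *)
Theorem perf_laurent_free : projective_free (predT : {pred S}).
Proof.
move=> N E _ EE.
have [m hm] : exists m, forall ij : 'I_N * 'I_N, forall e, e \in msupp (E ij.1 ij.2) -> level m e.
  apply: uniform_bound => [ij m m' le h e /h|ij]; first exact: level_mono.
  have [m hm] := @uniform_bound (msupp (E ij.1 ij.2)) (fun e m => level m (val e))
    (fun e _ _ => level_mono (e := val e)) (fun e => level_exists (val e)).
  by exists m => e he; apply: (hm [` he]%fset).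
pose tf := (@FracField.tofrac S).
have := @laurent_ring_free _ scalars (vars m (enum 'I_n)) (vars_independent m (enum_uniq _)).
move=> /(_ N (map_mx tf E)) [||r' [U [V [hU hV UV VU]]]].
- by apply/mxOverP => i j; rewrite mxE; apply: level_in => e; apply: (hm (i, j)).
- by rewrite -map_mxM EE.
have lift a b (M : 'M[L]_(a, b)) : M \is a mxOver (laurent_ring scalars (vars m (enum 'I_n))) ->
    exists M', map_mx tf M' = M.
  move=> /mxOverP hM.
  have /choice[f hf] ij : exists g : S, M ij.1 ij.2 = g%:F.
    by have /ring_involving/involvingP[g] := hM ij.1 ij.2; exists g.
  by exists (\matrix_(i, j) f (i, j)); apply/matrixP => i j; rewrite !mxE; exact/esym/(hf (i, j)).
have tf_inj : injective tf by move=> x y /eqP; rewrite tofrac_eq => /eqP.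
have [U' hU'] := lift _ _ _ hU; have [V' hV'] := lift _ _ _ hV.
have map_inj a b : injective (@map_mx _ _ tf a b).
  by move=> M M' /matrixP H; apply/matrixP => i j; have := H i j; rewrite !mxE => /tf_inj.
exists r', U', V'; split.
- by apply/mxOverP.
- by apply/mxOverP.
- by apply: map_inj; rewrite map_mxM hU' hV'.
- by apply: map_inj; rewrite map_mxM hU' hV' map_mx1.
Qed.

End Freeness.

(** * Modules and idempotent matrices *)

Section FreeModule.
Variables (S : comNzRingType) (M : lmodType S).

(** Projectivity gives a section h of the presentation g : S^d -> M, and h g is
    an idempotent matrix E.  If E = U V and V U = 1, the images under g of the rows of
    V form a basis: x has the coordinates h(x) U. *)
Lemma free_of_splitting : projective_free (predT : {pred S}) ->
  finitely_generated M -> projective M -> free_module M.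
Proof.
move=> splitS [d [s gens]] proj.
pose g0 (c : 'rV[S]_d) : M := \sum_i c 0 i *: s i.
have g0_lin : linear g0.
  move=> a c c'; rewrite /g0 scaler_sumr -big_split; apply: eq_bigr => i _ /=.
  by rewrite !mxE scalerDl scalerA.
pose gM := GRing.isLinear.Build S 'rV[S]_d M *:%R g0 g0_lin.
pose g : {linear 'rV[S]_d -> M} := HB.pack g0 gM.
have [|h hK] := proj _ _ g (idfun : {linear M -> M}).
  move=> y; have [c ->] := gens y; exists (\row_i c i).
  by rewrite /= /g0; apply: eq_bigr => i _; rewrite mxE.
have {}hK x : g (h x) = x by exact: hK.
pose E : 'M[S]_d := \matrix_i h (s i).
have hgE c : h (g c) = c *m E.
  rewrite /= /g0 linear_sum mulmx_sum_row; apply: eq_bigr => i _.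
  by rewrite linearZ rowK.
have EE : E *m E = E.
  by apply/row_matrixP => i; rewrite row_mul -hgE rowK hK.
have [|r [U [V [_ _ UV VU]]]] := splitS _ E _ EE; first exact/mxOverP.
pose b (i : 'I_r) : M := g (row i V).
have gV (c : 'rV[S]_r) : g (c *m V) = \sum_i c 0 i *: b i.
  by rewrite mulmx_sum_row linear_sum; apply: eq_bigr => i _; rewrite linearZ.
have fsum (c : {fsfun 'I_r -> S with 0}) :
    \sum_(i <- finsupp c) c i *: b i = g ((\row_i c i) *m V).
  rewrite gV [RHS](bigID (mem (finsupp c))) /= [X in _ = _ + X]big1 ?addr0 => [|i].
    rewrite big_uniq ?fset_uniq //=; apply: eq_bigr => i _; by rewrite mxE.
  by move/fsfun_dflt; rewrite mxE => ->; rewrite scale0r.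
exists 'I_r, b => x.
pose c := h x *m U; exists [fsfun i in [fset i | i : 'I_r]%fset => c 0 i].
have xc : x = g (c *m V) by rewrite /c -mulmxA UV -hgE !hK.
split.
  rewrite fsum {1}xc; congr (g (_ *m V)); apply/rowP => i.
  by rewrite [RHS]mxE fsfunE in_fset.
move=> c' xc'; apply/fsfunP => i; rewrite fsfunE in_fset /=.
suff -> : c = \row_i c' i by rewrite mxE.
by rewrite /c xc' fsum hgE -UV -!mulmxA VU mulmx1 VU mulmx1.
Qed.

End FreeModule.

Lemma projective_free_iso (R R' : comNzRingType) (phi : {rmorphism R -> R'}) :
  bijective phi -> projective_free (predT : {pred R}) -> projective_free (predT : {pred R'}).
Proof.
move=> bij hR n E _ EE; have [psi phiK psiK] := bij.
have mapK a b (M : 'M[R']_(a, b)) : map_mx phi (map_mx psi M) = M.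
  by apply/matrixP => i j; rewrite !mxE psiK.
have map_inj a b : injective (@map_mx _ _ phi a b).
  move=> M N /matrixP H; apply/matrixP => i j.
  by have := H i j; rewrite !mxE => /(can_inj phiK).
have [||r [U [V [_ _ UV VU]]]] := hR n (map_mx psi E); first exact/mxOverP.
  by apply: map_inj; rewrite map_mxM mapK.
exists r, (map_mx phi U), (map_mx phi V); split; try exact/mxOverP.
  by rewrite -map_mxM UV mapK.
by rewrite -map_mxM VU map_mx1.
Qed.

(** * The residue field and the reduction of the Tate algebra *)

Section MultiplicativeNorm.
Local Open Scope classical_set_scope.
Local Open Scope quotient_scope.

Variables (R : realType) (A : ultraRingType R).
Hypothesis normM : forall x y : A, unorm (x * y) = unorm x * unorm y.
Implicit Types x : A.

Lemma unormX x n : unorm (x ^+ n) = unorm x ^+ n.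
Proof. by elim: n => [|n IH]; rewrite ?unorm1 // !exprS normM IH. Qed.

Lemma top_nilpotentE x : (x \in @top_nilpotent _ A) = (unorm x < 1).
Proof.
apply/top_nilpotentP/idP => [/(_ 1 ltr01)[N /(_ N (leqnn N))]|x1 e e0].
  by rewrite unormX; apply: contraTT; rewrite -!leNgt => /(exprn_ege1 N).
have : (unorm x) ^+ n @[n --> \oo] --> (0 : R).
  by apply: cvg_expr; rewrite ger0_norm ?unorm_ge0.
move=> /cvgr0Pnorm_lt/(_ e e0)[N _ hN]; exists N => n /hN /=.
by rewrite unormX ger0_norm // exprn_ge0 // unorm_ge0.
Qed.

Lemma power_boundedE x : (x \in @power_bounded _ A) = (unorm x <= 1).
Proof.
apply/power_boundedP/idP => [[C hC]|x1]; last first.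
  by exists 1 => n; rewrite unormX exprn_ile1 // unorm_ge0.
rewrite leNgt; apply/negP => x1.
have x0 : 0 < unorm x by apply: lt_trans x1.
have C0 : 0 < C by apply: lt_le_trans (hC 0%N); rewrite expr0 unorm1.
have : (unorm x)^-1 ^+ n @[n --> \oo] --> (0 : R).
  by apply: cvg_expr; rewrite ger0_norm ?invr_ge0 ?unorm_ge0 // invf_lt1.
have CV : 0 < C^-1 by rewrite invr_gt0.
move=> /cvgr0Pnorm_lt/(_ _ CV)[N _ /(_ N (leqnn N))] /=.
rewrite ger0_norm ?exprn_ge0 ?invr_ge0 ?unorm_ge0 // exprVn ltf_pV2 ?posrE ?exprn_gt0 //.
by rewrite -unormX ltNge hC.
Qed.

Lemma red_eq (u v : bounded_ring A) : red u = red v <-> unorm (bval u - bval v) < 1.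
Proof.
rewrite -top_nilpotentE -[bval u - bval v]/(bval (u - v)).
have -> : (bval (u - v) \in @top_nilpotent _ A) = (u - v \in @nilpotent_ideal _ A) by [].
have -> : (u - v \in @nilpotent_ideal _ A) = (u == v %[mod {ideal_quot (@nilpotent_ideal _ A)}]).
  exact: Quotient.idealrBE.
by split=> [e|/eqP]; first by apply/eqP; exact: e.
Qed.

End MultiplicativeNorm.

Section Red.
Variables (R : realType) (A : ultraRingType R).

Lemma redD (u v : bounded_ring A) : red (u + v) = red u + red v.
Proof. exact: rmorphD. Qed.
Lemma redB (u v : bounded_ring A) : red (u - v) = red u - red v.
Proof. exact: rmorphB. Qed.
Lemma redM (u v : bounded_ring A) : red (u * v) = red u * red v.
Proof. exact: rmorphM. Qed.
Lemma red1 : red 1 = 1 :> reduction A.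
Proof. exact: rmorph1. Qed.
Lemma red0 : red 0 = 0 :> reduction A.
Proof. exact: rmorph0. Qed.
Lemma red_surj (x : reduction A) : exists u : bounded_ring A, x = red u.
Proof. by elim/quotW: x => u; exists u. Qed.

End Red.

Section ResidueField.
Variables (R : realType) (K : valuedFieldType R).

Let normM := @unormM R K.

(** An element of norm less than 1 reduces to 0, so x lifts to an element of norm 1. *)
Lemma residue_inverse (x : reduction K) : x != 0 -> exists y, y * x = 1.
Proof.
have [u ->] := red_surj x => u0.
have u1 : unorm (bval u) = 1.
  apply/le_anti; rewrite -(power_boundedE normM) bvalP /= leNgt; apply/negP => lt.
  by case/eqP: u0; rewrite -red0; apply/(red_eq normM); rewrite subr0.
have un0 : bval u != 0 by apply/eqP => /unorm_eq0/eqP; rewrite u1 oner_eq0.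
have hV : (bval u)^-1 \in @power_bounded _ K.
  have := normM (bval u)^-1 (bval u); rewrite mulVf // unorm1 u1 mulr1 => e.
  by rewrite (power_boundedE normM) -e.
exists (red (BoundedRing hV)); rewrite -redM -red1; congr red.
by apply: val_inj; rewrite /= mulVf.
Qed.

Definition residue_inv (x : reduction K) : reduction K :=
  if pselect (exists y, y * x = 1) is left h then sval (cid h) else 0.

Lemma residue_mulVf (x : reduction K) : x != 0 -> residue_inv x * x = 1.
Proof.
move=> /residue_inverse h; rewrite /residue_inv; case: pselect => // h'.
exact: (svalP (cid h')).
Qed.

Lemma residue_inv0 : residue_inv 0 = 0.
Proof.
rewrite /residue_inv; case: pselect => // h; have := svalP (cid h).
by move/eqP; rewrite mulr0 eq_sym oner_eq0.
Qed.

Definition residue_field : fieldType := HB.pack (reduction K)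
  (GRing.ComNzRing_isField.Build (reduction K) residue_mulVf residue_inv0).

End ResidueField.

Lemma unorm_sum_lt (R : realType) (A : ultraRingType R) (C : R) (I : eqType) (s : seq I) (F : I -> A) :
  0 < C -> (forall i, i \in s -> unorm (F i) < C) -> unorm (\sum_(i <- s) F i) < C.
Proof.
move=> C0 hF; rewrite big_seq; elim/big_ind: _ => //; first by rewrite unorm0.
by move=> x y hx hy; apply: le_lt_trans (unormD _ _) _; rewrite gt_max hx.
Qed.

Section GaussMultiplicative.
Variables (R : realType) (K : valuedFieldType R) (p r n : nat).
Local Notation S := (perf_laurent K p r n).
Implicit Types g h : S.

Let gaussE g : unorm g = gauss_norm g. Proof. by []. Qed.

Lemma gauss_norm_attained g : g != 0 ->
  [seq e <- (msupp g : seq _) | unorm (mcoeff e g) == unorm g] != [::].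
Proof.
move=> g0; rewrite -has_filter; apply/negPn/negP => /hasPn H.
have gpos : 0 < unorm g.
  by rewrite lt_def unorm_ge0 andbT; apply: contra g0 => /eqP/unorm_eq0/eqP.
suff : unorm g < unorm g by rewrite ltxx.
rewrite {1}gaussE /gauss_norm big_seq; elim/big_ind: _ => //.
  by move=> x y hx hy; rewrite gt_max hx.
by move=> e he; rewrite lt_def eq_sym (H e he) unorm_coeff_le.
Qed.

(** Among the pairs of exponents at which g and h attain their norms, one has a sum
    that no other such pair has.  At this sum, the coefficient of g h is a product of
    norm |g| |h| plus terms of smaller norm. *)
Lemma unorm_perf_laurentM g h : unorm (g * h) = unorm g * unorm h.
Proof.
have [->|g0] := eqVneq g 0; first by rewrite mul0r unorm0 mul0r.
have [->|h0] := eqVneq h 0; first by rewrite mulr0 unorm0 mulr0.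
have pos (f : S) : f != 0 -> 0 < unorm f.
  move=> f0; rewrite lt_def unorm_ge0 andbT.
  by apply: contra f0 => /eqP/unorm_eq0/eqP.
have [e [f [he hf H]]] := unique_sum (gauss_norm_attained g0) (gauss_norm_attained h0).
apply/le_anti; rewrite unormM_le /= leNgt; apply/negP => lt.
move: he hf; rewrite !mem_filter => /andP[/eqP ge se] /andP[/eqP hfe sf].
set N := unorm g * unorm h in lt.
have N0 : 0 < N by rewrite mulr_gt0 ?pos.
have small e' f' : e' \in msupp g -> f' \in msupp h -> (e', f') != (e, f) ->
    unorm ((mcoeff e' g * mcoeff f' h) *+ (e' + f' == e + f)) < N.
  move=> he' hf' ne; case: eqP => E; last by rewrite unorm0.
  have le1 : unorm (mcoeff e' g) <= unorm g := unorm_coeff_le _ _.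
  have le2 : unorm (mcoeff f' h) <= unorm h := unorm_coeff_le _ _.
  rewrite mulr1n unormM; have [e1|n1] := eqVneq (unorm (mcoeff e' g)) (unorm g).
    have [e2|n2] := eqVneq (unorm (mcoeff f' h)) (unorm h).
      have [||ee ff] := H e' f' _ _ E; rewrite ?mem_filter ?e1 ?e2 ?eqxx //.
      by case/eqP: ne; rewrite ee ff.
    by rewrite /N e1 ltr_pM2l ?pos // lt_def eq_sym n2.
  apply: le_lt_trans (_ : unorm (mcoeff e' g) * unorm h < _).
    by rewrite ler_wpM2l ?unorm_ge0.
  by rewrite /N ltr_pM2r ?pos // lt_def eq_sym n1.
have coeff : unorm (mcoeff (e + f) (g * h)) < N.
  exact: le_lt_trans (unorm_coeff_le _ _) lt.
have : mcoeff e g * mcoeff f h = mcoeff (e + f) (g * h)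
    - (\sum_(f' <- (msupp h `\ f)%fset) (mcoeff e g * mcoeff f' h) *+ (e + f' == e + f)
      + \sum_(e' <- (msupp g `\ e)%fset) \sum_(f' <- msupp h)
          (mcoeff e' g * mcoeff f' h) *+ (e' + f' == e + f)).
  rewrite [X in X - _]mcoeff_mul (big_fsetD1 e) //= (big_fsetD1 f) //= eqxx mulr1n.
  by rewrite -[X in X - _]addrA addrK.
move/(congr1 (@unorm R K)); rewrite unormM ge hfe => E.
suff : N < N by rewrite ltxx.
rewrite {1}/N E; apply: le_lt_trans (unormB _ _) _; rewrite gt_max coeff /=.
apply: le_lt_trans (unormD _ _) _; rewrite gt_max; apply/andP; split.
  apply: unorm_sum_lt => // f'; rewrite !inE => /andP[ne hf']; apply: small => //.
  by apply: contraNneq ne => -[->].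
apply: unorm_sum_lt => // e'; rewrite !inE => /andP[ne he'].
apply: unorm_sum_lt => // f' hf'; apply: small => //.
by apply: contraNneq ne => -[->].
Qed.

End GaussMultiplicative.

Section CompletionNorm.
Local Open Scope classical_set_scope.
Local Open Scope quotient_scope.

Variables (R : realType) (A : ultraRingType R).
Local Notation T := (completion A).

Lemma unorm_completionM : (forall x y : A, unorm (x * y) = unorm x * unorm y) ->
  forall x y : T, unorm (x * y) = unorm x * unorm y.
Proof.
move=> normM x y; rewrite -[LHS]/(completion_norm _) -[unorm x]/(completion_norm x).
rewrite -[unorm y]/(completion_norm y).
elim/quotW: x => u; elim/quotW: y => v.
rewrite -rmorphM !completion_norm_pi.
have h : unorm (cval u n) * unorm (cval v n) @[n --> \oo]
   --> cauchy_norm u * cauchy_norm v.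
  by apply: cvgM; apply: cauchy_norm_cvg.
have E : (fun m => unorm (cval (u * v) m)) = (fun m => unorm (cval u m) * unorm (cval v m)).
  by apply/funext => m; rewrite -normM.
have := @cauchy_norm_cvg _ _ (u * v); rewrite E => h'.
by apply: (cvg_unique _ h' h).
Qed.

Lemma to_completionB : {morph @to_completion R A : x y / x - y}.
Proof.
move=> x y; rewrite /to_completion -rmorphB; congr (\pi_(_) _).
by apply: val_inj.
Qed.

Lemma to_completionM : {morph @to_completion R A : x y / x * y}.
Proof.
move=> x y; rewrite /to_completion -rmorphM; congr (\pi_(_) _).
by apply: val_inj.
Qed.

Lemma to_completion1 : to_completion (1 : A) = 1.
Proof.
rewrite /to_completion -(rmorph1 (\pi_(completion A))); congr (\pi_(_) _).
by apply: val_inj.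
Qed.

HB.instance Definition _ := GRing.isZmodMorphism.Build A T (@to_completion R A) to_completionB.

Lemma unorm_to_completion (a : A) : unorm (to_completion a) = unorm a.
Proof.
rewrite -[LHS]/(completion_norm _) completion_norm_pi /cauchy_norm.
by apply: (@cvg_lim) => //; exact: (@cvg_cst _ (unorm a : R) _ _ _).
Qed.

Lemma completion_dense (x : T) (e : R) : 0 < e -> exists a : A, unorm (x - to_completion a) < e.
Proof.
move=> e0; elim/quotW: x => u.
have [N hN] := asboolW (cvalP u) (e / 2) (divr_gt0 e0 (ltr0Sn _ 1)).
exists (cval u N); apply: (@le_lt_trans _ _ (e / 2)); last first.
  by rewrite ltr_pdivrMr // ltr_pMr // ltr1n.
rewrite /to_completion -rmorphB -[leLHS]/(completion_norm _) completion_norm_pi.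
apply: limr_le; first by apply/cvg_ex; eexists; exact: cauchy_norm_cvg.
by exists N => // m /= hm; apply/ltW/(hN m N hm (leqnn N)).
Qed.

End CompletionNorm.

Section Evaluation.
Variables (A S : comNzRingType) (M : nmodType) (sigma : {rmorphism A -> S}) (chi : M -> S).
Hypotheses (chi0 : chi 0 = 1) (chiD : forall e f, chi (e + f) = chi e * chi f).
Local Notation AM := (monoid_algebra A M).

(** The morphism out of A[M] given by sigma on A and by chi on the monomials. *)
Definition malg_eval (g : AM) : S := \sum_(e <- msupp g) sigma (mcoeff e g) * chi e.

Lemma malg_evalw (d : {fset M}) (g : AM) : (msupp g `<=` d)%fset ->
  malg_eval g = \sum_(e <- d) sigma (mcoeff e g) * chi e.
Proof.
move=> le; apply: big_fset_incl => // e _ /mcoeff_outdom ->.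
by rewrite rmorph0 mul0r.
Qed.

Lemma malg_eval_zmod : zmod_morphism malg_eval.
Proof.
move=> g h; rewrite (malg_evalw (msuppB_le _ _)).
rewrite (malg_evalw (fsubsetUl (msupp g) (msupp h))) (malg_evalw (fsubsetUr (msupp g) (msupp h))).
rewrite -sumrB; apply: eq_bigr => e _.
by rewrite (mcoeffB e) rmorphB mulrBl.
Qed.

HB.instance Definition _ := GRing.isZmodMorphism.Build AM S malg_eval malg_eval_zmod.

Lemma malg_eval_term c e : malg_eval (mterm c e) = sigma c * chi e.
Proof.
by rewrite (malg_evalw (msuppU_le (k := e) (x := c))) big_seq_fset1 mcoeff_term eqxx.
Qed.

Lemma malg_eval_monoid : monoid_morphism malg_eval.
Proof.
split; first by rewrite -mterm_one malg_eval_term rmorph1 chi0 mulr1.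
move=> g h; rewrite [X in malg_eval (X * _)]mtermE [X in malg_eval (_ * X)]mtermE.
rewrite mulr_suml raddf_sum [X in X * _](_ : _ = \sum_(e <- msupp g) malg_eval (mterm (mcoeff e g) e));
  last by rewrite -raddf_sum -mtermE.
rewrite mulr_suml; apply: eq_bigr => e _.
rewrite mulr_sumr raddf_sum [X in _ * X](_ : _ = \sum_(e <- msupp h) malg_eval (mterm (mcoeff e h) e));
  last by rewrite -raddf_sum -mtermE.
rewrite mulr_sumr; apply: eq_bigr => f _.
by rewrite mtermM /= !malg_eval_term (rmorphM sigma) chiD mulrACA.
Qed.

End Evaluation.

Section TateReduction.
Variables (R : realType) (p : nat) (K : valuedFieldType R) (n : nat).
Local Notation expo := (exponent p n n).
Local Notation A0 := (perf_laurent K p n n).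
Local Notation T := (perfectoid_tate p K n).
Local Notation toC := (@to_completion R A0).
Implicit Types (c : bounded_ring K) (e : expo) (t : bounded_ring T).

Let normT (x y : T) : unorm (x * y) = unorm x * unorm y.
Proof. exact: (unorm_completionM (@unorm_perf_laurentM R K p n n)). Qed.

Let normK := @unormM R K.

Lemma unorm_toC (g : A0) : unorm (toC g : T) = unorm g.
Proof. exact: unorm_to_completion. Qed.

Lemma unorm_term (a : K) e : unorm (mterm a e : A0) <= unorm a.
Proof.
rewrite -[leLHS]/(gauss_norm _); apply: gauss_norm_le; first exact: unorm_ge0.
by move=> f; rewrite mcoeff_term; case: eqP => _; rewrite ?mulr0n ?unorm0 ?unorm_ge0.
Qed.

Lemma bounded_norm (u : bounded_ring K) : unorm (bval u) <= 1.
Proof. by rewrite -(power_boundedE normK) bvalP. Qed.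

Lemma term_bounded (a : K) e : unorm a <= 1 -> (toC (mterm a e) : T) \in @power_bounded _ T.
Proof.
move=> ha; rewrite (power_boundedE normT) unorm_toC.
exact: le_trans (unorm_term _ _) ha.
Qed.

Definition tate_scalar c : bounded_ring T := BoundedRing (term_bounded 0 (bounded_norm c)).

Lemma unorm1_le : unorm (1 : K) <= 1. Proof. by rewrite unorm1. Qed.

Definition tate_monomial e : bounded_ring T := BoundedRing (term_bounded e unorm1_le).

(** The residue field maps to the reduction through constants; [repr] chooses a lift,
    on which the result does not depend ([residue_scalar_red]). *)
Definition residue_scalar (x : reduction K) : reduction T := red (tate_scalar (repr x)).

Lemma mtermB (a b : K) e : mterm (a - b) e = mterm a e - mterm b e :> A0.
Proof. exact: (raddfB (@mkmalgU _ _ e)). Qed.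

Lemma residue_scalar_red c : residue_scalar (red c) = red (tate_scalar c).
Proof.
apply/(red_eq normT); rewrite /= -[X in unorm X](@to_completionB _ A0) -mtermB unorm_toC.
apply: le_lt_trans (unorm_term _ _) _; apply/(red_eq normK).
exact: reprK.
Qed.

Lemma residue_scalar_zmod : zmod_morphism residue_scalar.
Proof.
move=> x y; have [a ->] := red_surj x; have [b ->] := red_surj y.
rewrite -redB !residue_scalar_red -redB; congr red; apply: val_inj => /=.
by rewrite mtermB to_completionB.
Qed.

Lemma residue_scalar_monoid : monoid_morphism residue_scalar.
Proof.
split=> [|x y].
  rewrite -red1 residue_scalar_red -red1; congr red; apply: val_inj => /=.
  exact: to_completion1.
have [a ->] := red_surj x; have [b ->] := red_surj y.
rewrite -redM !residue_scalar_red -redM; congr red; apply: val_inj => /=.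
rewrite -[RHS](@to_completionM _ A0); congr (toC _).
by rewrite -[RHS]/(mterm _ _ * mterm _ _ : monoid_algebra K expo) mtermM addr0.
Qed.

HB.instance Definition _ := GRing.isZmodMorphism.Build (reduction K) (reduction T)
  residue_scalar residue_scalar_zmod.
HB.instance Definition _ := GRing.isMonoidMorphism.Build (reduction K) (reduction T)
  residue_scalar residue_scalar_monoid.

Let chi e : reduction T := red (tate_monomial e).

Lemma chi0 : chi 0 = 1.
Proof. by rewrite -red1; congr red; apply: val_inj; exact: to_completion1. Qed.

Lemma chiD e f : chi (e + f) = chi e * chi f.
Proof.
rewrite -redM; congr red; apply: val_inj => /=.
rewrite -[RHS](@to_completionM _ A0); congr (toC _).
by rewrite -[RHS]/(mterm _ _ * mterm _ _ : monoid_algebra K expo) mtermM mulr1.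
Qed.

Definition tate_residue_map : {rmorphism perf_laurent (reduction K) p n n -> reduction T} :=
  HB.pack (malg_eval (residue_scalar : {rmorphism _ -> _}) chi)
    (GRing.isZmodMorphism.Build _ _ _ (malg_eval_zmod (residue_scalar : {rmorphism _ -> _}) chi))
    (GRing.isMonoidMorphism.Build _ _ _ (malg_eval_monoid (residue_scalar : {rmorphism _ -> _}) chi0 chiD)).

Lemma tate_residue_map_term c e :
  tate_residue_map (mterm (red c) e) = red (tate_scalar c * tate_monomial e).
Proof. by rewrite [LHS]malg_eval_term redM -residue_scalar_red. Qed.

Lemma tate_residue_map_sum (s : seq expo) (c : expo -> bounded_ring K) t :
  bval t = toC (\sum_(e <- s) mterm (bval (c e)) e) ->
  tate_residue_map (\sum_(e <- s) mterm (red (c e)) e) = red t.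
Proof.
move=> ht; rewrite raddf_sum /=.
have -> : t = \sum_(e <- s) tate_scalar (c e) * tate_monomial e.
  apply: val_inj; rewrite [LHS]ht (raddf_sum val) (raddf_sum toC); apply: eq_bigr => e _ /=.
  rewrite -[RHS](@to_completionM _ A0); congr (toC _).
  by rewrite -[RHS]/(mterm _ _ * mterm _ _ : monoid_algebra K expo) mtermM mulr1 add0r.
rewrite (big_morph _ (@redD _ T) (@red0 _ T)); apply: eq_bigr => e _.
exact: tate_residue_map_term.
Qed.

Lemma tate_residue_map_compat c e t : bval t = toC (mterm (bval c) e) ->
  tate_residue_map (mterm (red c) e) = red t.
Proof.
move=> ht; have := @tate_residue_map_sum [:: e] (fun=> c) t.
by rewrite !big_seq1; apply.
Qed.

(** A power-bounded element is at distance less than 1 from a polynomial, whose norm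
    is then at most 1, and both have the same reduction. *)
Lemma tate_residue_map_surj (y : reduction T) : exists g, tate_residue_map g = y.
Proof.
have [t ->] := red_surj y.
have [g hg] := @completion_dense R A0 (bval t) 1 ltr01.
have g1 : unorm g <= 1.
  rewrite -unorm_toC -(subrK (bval t) (toC g : T)); apply: unormD_bound.
    by rewrite unormBC ltW.
  by rewrite -(power_boundedE normT) bvalP.
have hc e : mcoeff e g \in @power_bounded _ K.
  by rewrite (power_boundedE normK); apply: le_trans (unorm_coeff_le _ _) g1.
have ht' : (toC g : T) \in @power_bounded _ T by rewrite (power_boundedE normT) unorm_toC.
exists (\sum_(e <- msupp g) mterm (red (BoundedRing (hc e))) e).
rewrite (@tate_residue_map_sum _ (fun e => BoundedRing (hc e)) (BoundedRing ht')).
  by apply/(red_eq normT); rewrite unormBC.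
by rewrite /=; congr (toC _); exact: mtermE.
Qed.

(** Lift the coefficients to norm at most 1.  If the lifted polynomial has norm less
    than 1, all coefficients of G are zero. *)
Lemma tate_residue_map_inj : injective tate_residue_map.
Proof.
apply: raddf_inj => G hG.
have /choice[c hc] e : exists c, mcoeff e G = red c by apply: red_surj.
pose g : A0 := \sum_(e <- msupp G) mterm (bval (c e)) e.
have gE e : e \in msupp G -> mcoeff e g = bval (c e).
  move=> he; rewrite /g (raddf_sum (mcoeff e)) (big_fsetD1 e) //= mcoeff_term eqxx.
  rewrite big1_seq ?addr0 // => f /andP[_]; rewrite !inE => /andP[ne _].
  by rewrite mcoeff_term (negPf ne).
have g1 : unorm g <= 1.
  apply: unorm_sum => // e _; exact: le_trans (unorm_term _ _) (bounded_norm _).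
have ht : (toC g : T) \in @power_bounded _ T by rewrite (power_boundedE normT) unorm_toC.
have GE : G = \sum_(e <- msupp G) mterm (red (c e)) e.
  by rewrite [LHS]mtermE; apply: eq_bigr => e _; rewrite hc.
have E : tate_residue_map G = red (BoundedRing ht).
  by rewrite {1}GE; apply: tate_residue_map_sum.
have : red (BoundedRing ht) = red 0 by rewrite -E red0.
move/(red_eq normT); rewrite /= subr0 unorm_toC => lt.
apply/malgP => e; rewrite mcoeff0.
have [he|/mcoeff_outdom//] := boolP (e \in msupp G).
rewrite hc -(@red0 _ K); apply/(red_eq normK); rewrite /= subr0 -gE //.
exact: le_lt_trans (unorm_coeff_le _ _) lt.
Qed.

Lemma tate_residue_map_bij : bijective tate_residue_map.
Proof.
have /choice[psi hpsi] := tate_residue_map_surj.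
by exists psi => [g|//]; apply: tate_residue_map_inj; rewrite hpsi.
Qed.

End TateReduction.

Theorem corollary2p12 (R : realType) (p : nat) (K : valuedFieldType R)
    (hK : is_perfectoid p K) (r n : nat) (hrn : (r <= n)%N) :
  (forall M : lmodType (perf_laurent (reduction K) p r n),
     finitely_generated M -> projective M -> free_module M) /\
  (exists phi : {rmorphism perf_laurent (reduction K) p n n ->
                           reduction (perfectoid_tate p K n)},
     bijective phi /\
     forall (c : bounded_ring K) (e : exponent p n n)
            (t : bounded_ring (perfectoid_tate p K n)),
       bval t = to_completion (mterm (bval c) e : perf_laurent K p n n) ->
       phi (mterm (red c) e) = red t) /\
  (forall M : lmodType (reduction (perfectoid_tate p K n)),
     finitely_generated M -> projective M -> free_module M).
Proof.
have p_pr : prime p by case: hK => _ _ /andP[].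
have free r' : projective_free (predT : {pred perf_laurent (reduction K) p r' n}).
  exact: (@perf_laurent_free (residue_field K) p r' n p_pr).
split; first by move=> M; apply/free_of_splitting/free.
split.
  exists (tate_residue_map p K n); split; first exact: tate_residue_map_bij.
  by move=> c e t; apply: tate_residue_map_compat.
move=> M; apply: free_of_splitting.
exact: projective_free_iso (tate_residue_map_bij p K n) (free n).
Qed.
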